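(* Let $X$ be a finite alphabet, $t\notin X$ a letter, and let $u,v\in\overline{X}^*$ be non-empty reduced words. Then the prefix membership problem is decidable for the group defined by the (conjugacy pinched) presentation $$\mathrm{Gp}\langle X\cup\{t\}\,|\,t^{-1}utv^{-1}=1\rangle.$$ Consequently, the word problem is decidable for the one-relator inverse monoid $$\mathrm{Inv}\langle X\cup\{t\}\,|\,t^{-1}utv^{-1}=1\rangle.$$
   Context: For an alphabet $Z$, $\overline{Z}=Z\cup Z^{-1}$. $\mathrm{Gp}\langle Z\,|\,w=1\rangle$ and $\mathrm{Inv}\langle Z\,|\,w=1\rangle$ are the group, respectively the inverse monoid, presented by generators $Z$ and relation $w=1$ (the latter is the quotient of the free inverse monoid on $Z$ by the congruence generated by $(w,1)$). The prefix monoid $P_w$ is the submonoid of $G=\mathrm{Gp}\langle Z\,|\,w=1\rangle$ generated by the elements represented by all prefixes of $w$. The prefix membership problem for $\mathrm{Gp}\langle Z\,|\,w=1\rangle$ is decidable if there is an algorithm which, given $p\in\overline{Z}^*$, decides whether the element of $G$ represented by $p$ lies in $P_w$. The word problem of the inverse monoid is to decide, given two words over $\overline{Z}$, whether they represent the same element. *)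

(* Defs.v *)
From HB Require Import structures.
From mathcomp Require Import all_boot boolp.

Set Implicit Arguments.
Unset Strict Implicit.
Unset Printing Implicit Defensive.

Local Open Scope group_scope.
Local Open Scope quotient_scope.

(* Words over Z \cup Z^-1: the letter (z, false) is z and (z, true) is z^-1.  *)
(* word Z is the free monoid with the formal inversion of words.              *)
Definition word (Z : Type) : Type := seq (Z * bool).

HB.instance Definition _ (Z : choiceType) :=
  Choice.copy (word Z) (seq (Z * bool)).

Section Words.
Variable Z : choiceType.

Definition letter_inv (a : Z * bool) : Z * bool := (a.1, ~~ a.2).

Definition word_inv (x : word Z) : word Z := rev (map letter_inv x).

Fact letter_invK : involutive letter_inv.
Proof. by case=> z b; rewrite /letter_inv /= negbK. Qed.

Fact word_invK : involutive word_inv.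
Proof. by move=> x; rewrite /word_inv map_rev revK mapK //; apply: letter_invK. Qed.

Fact word_invM : {morph word_inv : x y / x ++ y >-> y ++ x}.
Proof. by move=> x y; rewrite /word_inv map_cat rev_cat. Qed.

HB.instance Definition _ :=
  isStarMonoid.Build (word Z) (@catA _) (@cat0s _) word_invK word_invM.

Definition reduced (x : word Z) : bool :=
  sorted (fun a b => b != letter_inv a) x.

End Words.

Definition map_word (Y Z : Type) (f : Y -> Z) (x : word Y) : word Z :=
  [seq (f a.1, a.2) | a <- x].

(* The least monoid congruence containing R, and the quotient by it.          *)
Section Quotient.
Variables (M : monoidType) (R : M -> M -> Prop).

Inductive congruence : M -> M -> Prop :=
| cong_base x y of R x y : congruence x y
| cong_refl x : congruence x x
| cong_sym x y of congruence x y : congruence y x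
| cong_trans y x z of congruence x y & congruence y z : congruence x z
| cong_mul x x' y y' of congruence x x' & congruence y y' :
    congruence (x * y) (x' * y').

Definition congb (x y : M) : bool := `[< congruence x y >].

Fact congb_refl : reflexive congb.
Proof. by move=> x; apply/asboolP/cong_refl. Qed.

Fact congb_sym : symmetric congb.
Proof. by move=> x y; apply/asboolP/asboolP => /cong_sym. Qed.

Fact congb_trans : transitive congb.
Proof. by move=> y x z /asboolP xy /asboolP yz; apply/asboolP/(cong_trans xy). Qed.

Canonical congb_equiv := EquivRel congb congb_refl congb_sym congb_trans.

Definition mquot : Type := {eq_quot congb_equiv}.

HB.instance Definition _ := Choice.copy mquot {eq_quot congb_equiv}.

Definition mclass (x : M) : mquot := \pi_{eq_quot congb_equiv} x.

Lemma mclassP x y : mclass x = mclass y <-> congruence x y.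
Proof. by split=> [/eqmodP/asboolP | /asboolP xy]; last apply/eqmodP. Qed.

Definition mquot_repr (g : mquot) : M := repr (g : {eq_quot congb_equiv}).

Fact mquot_reprK : cancel mquot_repr mclass.
Proof. by move=> g; apply: (@reprK _ {eq_quot congb_equiv}). Qed.

Definition mquot_mul (g h : mquot) : mquot :=
  mclass (mquot_repr g * mquot_repr h).

Lemma mclassM x y : mquot_mul (mclass x) (mclass y) = mclass (x * y).
Proof. by apply/mclassP/cong_mul; apply/mclassP; rewrite mquot_reprK. Qed.

Fact mquot_mulA : associative mquot_mul.
Proof.
move=> g h k; rewrite -(mquot_reprK g) -(mquot_reprK h) -(mquot_reprK k).
by rewrite !mclassM mulgA.
Qed.

Fact mquot_mul1 : left_id (mclass 1) mquot_mul.
Proof. by move=> g; rewrite -(mquot_reprK g) mclassM mul1g. Qed.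

Fact mquot_mulr1 : right_id (mclass 1) mquot_mul.
Proof. by move=> g; rewrite -(mquot_reprK g) mclassM mulg1. Qed.

HB.instance Definition _ :=
  isMonoid.Build mquot mquot_mulA mquot_mul1 mquot_mulr1.

End Quotient.

Section GroupQuotient.
Variables (G : groupType) (R : G -> G -> Prop).

Definition gquot : Type := mquot R.

HB.instance Definition _ := Monoid.copy gquot (mquot R).

Definition gclass (x : G) : gquot := mclass R x.

Definition gquot_inv (g : gquot) : gquot := gclass (mquot_repr g)^-1.

Fact gquot_mulVg : left_inverse 1 gquot_inv (@mul gquot).
Proof.
move=> g; rewrite -[g in _ * g]mquot_reprK.
by transitivity (mclass R ((mquot_repr g)^-1 * mquot_repr g));
  [exact: mclassM | rewrite mulVg].
Qed.

Fact gquot_mulgV : right_inverse 1 gquot_inv (@mul gquot).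
Proof.
move=> g; rewrite -[g in g * _]mquot_reprK.
by transitivity (mclass R (mquot_repr g * (mquot_repr g)^-1));
  [exact: mclassM | rewrite mulgV].
Qed.

HB.instance Definition _ := hasInv.Build gquot gquot_inv.
HB.instance Definition _ := Monoid_isGroup.Build gquot gquot_mulVg gquot_mulgV.

End GroupQuotient.

Section FreeGroup.
Variable Z : choiceType.

Inductive free_reduction : word Z -> word Z -> Prop :=
| Cancel (a : Z * bool) : free_reduction [:: a; letter_inv a] 1.

Definition free_group : Type := mquot free_reduction.

HB.instance Definition _ := Monoid.copy free_group (mquot free_reduction).

Definition free_class (x : word Z) : free_group := mclass free_reduction x.

Fact free_mulgV (x : word Z) : free_class (x * x^-1) = free_class 1.
Proof.
elim: x => [//|a x0]; set x : word Z := x0 => IHx; apply/mclassP.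
pose l : word Z := [:: a].
have -> : (l * x) * (l * x)^-1 = l * (x * x^-1) * [:: letter_inv a].
  by rewrite invgM !mulgA.
have aa : congruence free_reduction
    (l * 1 * [:: letter_inv a]) 1.
  exact/cong_base/Cancel.
apply: cong_trans aa; apply: cong_mul; last exact: cong_refl.
by apply: cong_mul; [exact: cong_refl | apply/mclassP].
Qed.

Definition free_inv (g : free_group) : free_group :=
  free_class (mquot_repr g)^-1.

Fact free_group_mulgV : right_inverse 1 free_inv (@mul free_group).
Proof.
move=> g; rewrite -[g in g * _]mquot_reprK.
by transitivity (free_class (mquot_repr g * (mquot_repr g)^-1));
  [exact: mclassM | exact: free_mulgV].
Qed.

Fact free_group_mulVg : left_inverse 1 free_inv (@mul free_group).
Proof.
move=> g; rewrite -[g in _ * g]mquot_reprK.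
transitivity (free_class ((mquot_repr g)^-1 * mquot_repr g)).
  exact: mclassM.
by rewrite -[X in _ * X]invgK free_mulgV.
Qed.

HB.instance Definition _ := hasInv.Build free_group free_inv.
HB.instance Definition _ :=
  Monoid_isGroup.Build free_group free_group_mulVg free_group_mulgV.

End FreeGroup.

(* The Vagner relations present the free inverse monoid.                      *)
Section FreeInverseMonoid.
Variable Z : choiceType.

Inductive vagner : word Z -> word Z -> Prop :=
| VagnerInv (x : word Z) : vagner (x * x^-1 * x) x
| VagnerComm (x y : word Z) :
    vagner (x * x^-1 * (y * y^-1)) (y * y^-1 * (x * x^-1)).

Definition free_inverse_monoid : Type := mquot vagner.

HB.instance Definition _ := Monoid.copy free_inverse_monoid (mquot vagner).

Definition fim_class (x : word Z) : free_inverse_monoid := mclass vagner x.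

End FreeInverseMonoid.

Section OneRelator.
Variables (Z : choiceType) (w : word Z).

Definition Gp : Type :=
  gquot (fun g h : free_group Z => g = free_class w /\ h = 1).

HB.instance Definition _ := Group.copy Gp
  (gquot (fun g h : free_group Z => g = free_class w /\ h = 1)).

Definition Gp_elt (x : word Z) : Gp := gclass _ (free_class x).

Definition Inv : Type :=
  mquot (fun g h : free_inverse_monoid Z => g = fim_class w /\ h = 1).

HB.instance Definition _ := Monoid.copy Inv
  (mquot (fun g h : free_inverse_monoid Z => g = fim_class w /\ h = 1)).

Definition Inv_elt (x : word Z) : Inv := mclass _ (fim_class x).

End OneRelator.

Inductive submonoid_gen (M : monoidType) (S : M -> Prop) : M -> Prop :=
| gen_base x of S x : submonoid_gen S x
| gen_one : submonoid_gen S 1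
| gen_mul x y of submonoid_gen S x & submonoid_gen S y :
    submonoid_gen S (x * y).

Definition prefix_monoid (Z : choiceType) (w : word Z) : Gp w -> Prop :=
  submonoid_gen (fun g => exists2 q : word Z, prefix q w & g = Gp_elt w q).

(* The total (general) recursive functions, with minimization restricted to   *)
(* regular functions. This is a set of functions, not of programs, so it is   *)
(* closed under pointwise equality (rec_ext).                                 *)
Inductive recursive : forall n, (n.-tuple nat -> nat) -> Prop :=
| rec_zero : @recursive 0 (fun=> 0)
| rec_succ : @recursive 1 (fun v => (thead v).+1)
| rec_proj n (i : 'I_n) : @recursive n (fun v => tnth v i)
| rec_comp n m (f : m.-tuple nat -> nat) (g : 'I_m -> n.-tuple nat -> nat)
    of recursive f & (forall i, recursive (g i)) :
    @recursive n (fun v => f [tuple g i v | i < m])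
| rec_prim n (f : n.-tuple nat -> nat) (g : n.+2.-tuple nat -> nat)
    of recursive f & recursive g :
    @recursive n.+1 (fun v =>
      nat_rect (fun=> nat) (f [tuple of behead v])
        (fun k r => g [tuple of k :: r :: behead v]) (thead v))
| rec_min n (f : n.+1.-tuple nat -> nat)
    (f_regular : forall v : n.-tuple nat, exists k, f [tuple of k :: v] == 0)
    of recursive f :
    @recursive n (fun v => ex_minn (f_regular v))
| rec_ext n (f g : n.-tuple nat -> nat) of recursive f & f =1 g : recursive g.

(* Gödel number of a word; letters are numbered by their position in the      *)
(* enumeration of the finite alphabet.                                        *)
Definition word_code (Z : finType) (x : word Z) : nat :=
  CodeSeq.code [seq nat_of_ord (enum_rank a) | a <- x].

Definition prefix_membership_decidable (Z : finType) (w : word Z) : Prop :=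
  exists2 f : 1.-tuple nat -> nat, recursive f &
    forall p : word Z,
      f [tuple word_code p] = 1%N <-> prefix_monoid (Gp_elt w p).

Definition Inv_word_problem_decidable (Z : finType) (w : word Z) : Prop :=
  exists2 f : 2.-tuple nat -> nat, recursive f &
    forall x y : word Z,
      f [tuple word_code x; word_code y] = 1%N <-> Inv_elt w x = Inv_elt w y.

(* Main.v *)
(* The group G = Gp<X, t | t^-1 u t = v> is an HNN extension of the free group F on X, and the
   prefix monoid P is generated by the prefixes of v and by t^-1 p for the prefixes p of u. Its
   normal forms r_1 t^-1 r_2 ... t^-1 h contain no positive power of t. Sliding powers of v across
   t^-1, such an element lies in P iff there are integers k_i such that r_1 v^k_1 is in the monoid Q
   generated by the prefixes of v, u^-k_i r_(i+1) v^k_(i+1) is in pref(u) Q, and so on. As v is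
   in Q, the set of admissible k_i is an up-set of the integers: empty, everything, or a ray
   [K, oo). Hence the elements h that complete a given stack of r_i form a set a R, where R is one
   of four rational subsets of F. By Benois' theorem, R is recognized on reduced words by a finite
   automaton, and pumping in that automaton bounds K.

   For the inverse monoid, every path of a Schuetzenberger graph follows the normal form of its
   label, because a pinch t^-1 u^k t or t v^k t^-1 can be bypassed along v^k or u^k. So these graphs
   are full subgraphs of the Cayley graph of G, and x = y in the inverse monoid iff x = y in G and
   the unions of the sets x' P, for the prefixes x' of x, and of y' P, for the prefixes y' of y,
   coincide. This reduces the word problem to the prefix membership problem. *)
Require Import Defs.
From mathcomp Require Import all_boot boolp zify.

Set Implicit Arguments.
Unset Strict Implicit.
Unset Printing Implicit Defensive.

(** * Recursive functions *)

(** A ray [[K, oo)] of exponents contributes the union of the sets [u^k pref(u) Q] over [k >= K],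
    which is [u^K] times a set that does not depend on [K]. So, whatever the height of the stack,
    the sets [R] are the empty set, [Q], and the unions of [u^k pref(u) Q] over all [k >= 0] or over
    all integers [k]. What passes from one stack level to the next is a finite tag and one element
    of [F]; without this, the unbounded choice of the [k_i] would give only a semi-decision.

    The quotients are taken by congruences decided classically, so nothing can be computed from a
    class itself. Elements of [F] are handled through their reduced words, those of the extension
    through normal forms, and every search for an exponent has an explicit bound. The automaton is
    found classically too, which is harmless: for fixed [u] and [v] it is a finite table. Uniqueness
    of normal forms, in [F] and in the extension, is obtained by van der Waerden's method: words act
    on the normal forms. *)

Definition rec1 (f : nat -> nat) := recursive (fun v : 1.-tuple nat => f (thead v)).
Definition rec2 (f : nat -> nat -> nat) :=
  recursive (fun v : 2.-tuple nat => f (thead v) (tnth v (inord 1))).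

Lemma rec_comp1 n f (g : n.-tuple nat -> nat) :
  rec1 f -> recursive g -> recursive (fun v => f (g v)).
Proof.
move=> Hf Hg; pose G (i : 'I_1) := g.
by apply: (rec_ext (rec_comp (g := G) Hf _)) => [|v] //=; rewrite /thead tnth_mktuple.
Qed.

Lemma rec_comp2 n f (g h : n.-tuple nat -> nat) :
  rec2 f -> recursive g -> recursive h -> recursive (fun v => f (g v) (h v)).
Proof.
move=> Hf Hg Hh; pose G (i : 'I_2) := if val i == 0 then g else h.
apply: (rec_ext (rec_comp (g := G) Hf _)) => [|v] /=.
  by move=> i; rewrite /G; case: ifP.
by rewrite /thead !tnth_mktuple /G /= inordK.
Qed.

Lemma rec_ext2 f g : rec2 f -> f =2 g -> rec2 g.
Proof. by move=> Hf e; apply: (rec_ext Hf) => v; rewrite e. Qed.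

Lemma rec_ext1 f g : rec1 f -> f =1 g -> rec1 g.
Proof. by move=> Hf e; apply: (rec_ext Hf) => v; rewrite e. Qed.

Lemma rec1_id : rec1 id. Proof. exact: rec_proj. Qed.

Lemma rec_const n k : recursive (fun _ : n.-tuple nat => k).
Proof.
elim: k => [|k IH]; last exact: (rec_comp1 rec_succ IH).
by apply: (rec_ext (rec_comp (g := fun i : 'I_0 => fun v : n.-tuple nat => 0) rec_zero _)) => [[]|].
Qed.

Lemma rec2_fst : rec2 (fun m n => m). Proof. exact: rec_proj. Qed.
Lemma rec2_snd : rec2 (fun m n => n). Proof. exact: rec_proj. Qed.

Lemma eq_nat_rect a (f g : nat -> nat -> nat) n :
  f =2 g -> nat_rect (fun=> nat) a f n = nat_rect (fun=> nat) a g n.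
Proof. by move=> e; elim: n => //= n ->. Qed.

Lemma rec2_iter f g : rec1 f -> rec2 g -> rec2 (fun n c => iter n (g c) (f c)).
Proof.
move=> Hf Hg.
(* The step of a primitive recursion receives the counter, the previous value and the parameter, in
   this order; the counter is ignored. *)
pose G (v : 3.-tuple nat) := g (tnth v (inord 2)) (tnth v (inord 1)).
have HG : recursive G by apply: rec_comp2 => //; apply: rec_proj.
apply: (rec_ext (rec_prim Hf HG)) => v; rewrite /=.
case/tupleP: v => n w; case/tupleP: w => c w; rewrite (tuple0 w) {w}.
rewrite theadE; have -> : tnth [tuple of n :: [tuple of c :: [tuple]]] (inord 1) = c.
  by rewrite (tnth_nth 0) /= inordK.
have -> : [tuple of behead [tuple of n :: [tuple of c :: [tuple]]]] = [tuple c] :> 1.-tuple nat.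
  exact: val_inj.
rewrite (@eq_nat_rect _ _ (fun=> g c)) => [|k r].
  by elim: n => //= n ->.
by rewrite /G !(tnth_nth 0) /= !inordK.
Qed.

Lemma rec2_comp f g h : rec2 f -> rec2 g -> rec2 h -> rec2 (fun m n => f (g m n) (h m n)).
Proof. by move=> Hf Hg Hh; exact: (rec_comp2 Hf Hg Hh). Qed.

Lemma rec21_comp f g : rec1 f -> rec2 g -> rec2 (fun m n => f (g m n)).
Proof. by move=> Hf Hg; exact: (rec_comp1 Hf Hg). Qed.

Lemma rec12_comp f g h : rec2 f -> rec1 g -> rec1 h -> rec1 (fun n => f (g n) (h n)).
Proof. by move=> Hf Hg Hh; exact: (rec_comp2 Hf Hg Hh). Qed.

Lemma rec11_comp f g : rec1 f -> rec1 g -> rec1 (fun n => f (g n)).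
Proof. by move=> Hf Hg; exact: (rec_comp1 Hf Hg). Qed.

Lemma rec1_const k : rec1 (fun=> k). Proof. exact: rec_const. Qed.
Lemma rec2_const k : rec2 (fun _ _ => k). Proof. exact: rec_const. Qed.

Lemma rec2_add : rec2 addn.
Proof.
apply: (rec_ext2 (rec2_iter rec1_id (rec21_comp rec_succ rec2_snd))) => m n.
by elim: m => //= m ->; rewrite addSn.
Qed.

Lemma rec2_mul : rec2 muln.
Proof.
apply: (rec_ext2 (rec2_iter (rec1_const 0) rec2_add)) => m n.
by elim: m => //= m ->; rewrite mulSn.
Qed.

Lemma rec1_double : rec1 double.
Proof. by apply: (rec_ext1 (rec12_comp rec2_add rec1_id rec1_id)) => n; rewrite addnn. Qed.

Lemma rec1_exp2 : rec1 (expn 2).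
Proof.
apply: (rec_ext1 (rec12_comp
  (rec2_iter (rec1_const 1) (rec21_comp rec1_double rec2_snd)) rec1_id rec1_id)).
by elim=> //= n ->; rewrite expnS mul2n.
Qed.

(** This is how [CodeSeq.code] puts an element in front of a list: the code of a nonempty list is
    the pair of its head and the code of its tail, while [0], the code of the empty list, is not a
    pair. *)
Definition pairn m n := 2 ^ m * n.*2.+1.

Lemma rec2_pairn : rec2 pairn.
Proof.
apply: rec2_comp rec2_mul _ _; first exact: rec21_comp rec1_exp2 rec2_fst.
exact: rec21_comp rec_succ (rec21_comp rec1_double rec2_snd).
Qed.

Lemma rec1_prim a f : rec2 f -> rec1 (nat_rect (fun=> nat) a f).
Proof.
move=> Hf.
pose G (v : 2.-tuple nat) := f (thead v) (tnth v (inord 1)).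
have HG : recursive G by exact: Hf.
apply: (rec_ext (rec_prim (rec_const 0 a) HG)) => v /=.
case/tupleP: v => n w; rewrite (tuple0 w) {w} theadE.
rewrite (@eq_nat_rect _ _ f) => [|k r]; first by elim: n => //= n ->.
by rewrite /G theadE (tnth_nth 0) /= inordK.
Qed.

Lemma rec1_eq0 : rec1 (fun n => n == 0).
Proof. apply: (rec_ext1 (rec1_prim 1 (rec2_const 0))); by case. Qed.

Lemma rec1_odd : rec1 (fun n => odd n).
Proof.
apply: (rec_ext1 (rec1_prim 0 (rec21_comp rec1_eq0 rec2_snd))).
by elim=> //= n ->; case: (odd n).
Qed.

Lemma rec1_half : rec1 half.
Proof.
apply: (rec_ext1 (rec1_prim 0 (rec2_comp rec2_add (rec21_comp rec1_odd rec2_fst) rec2_snd))).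
by elim=> //= n ->; rewrite uphalf_half.
Qed.

Lemma rec1_pred : rec1 predn.
Proof. apply: (rec_ext1 (rec1_prim 0 rec2_fst)); by case. Qed.

Lemma rec2_sub : rec2 subn.
Proof.
have H := rec2_iter rec1_id (rec21_comp rec1_pred rec2_snd).
apply: (rec_ext2 (rec2_comp H rec2_snd rec2_fst)) => m n.
by elim: n => [|n /= ->]; rewrite ?subn0 ?subnS.
Qed.

Lemma rec2_eq : rec2 (fun m n => m == n).
Proof.
have H : rec2 (fun m n => (m - n) + (n - m)).
  apply: rec2_comp rec2_add rec2_sub _; exact: rec2_comp rec2_sub rec2_snd rec2_fst.
apply: (rec_ext2 (rec21_comp rec1_eq0 H)) => m n.
by rewrite addn_eq0 !subn_eq0 -eqn_leq.
Qed.

(* [0] has no preimage under [pairn], so the search for the 2-adic valuation is guarded there. *)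
Fact unpair_ex p : exists k, (p == 0) || odd (iter k half p).
Proof.
case: p => [|p]; first by exists 0.
elim/ltn_ind: p => p IH; case: (boolP (odd p.+1)) => [o|e]; first by exists 0.
have : p.+1./2 < p.+1 by rewrite ltn_half_double -addnn -[X in X < _]addn0 ltn_add2l.
case E : (p.+1./2) => [|q]; first by move: (half_gt0 p.+1); rewrite E; case: (p) e.
rewrite ltnS => /IH [k Hk]; exists k.+1.
by rewrite iterSr E.
Qed.

Definition fstn p := ex_minn (unpair_ex p).
Definition sndn p := half (iter (fstn p) half p).

Lemma fstn_pairn m n : fstn (pairn m n) = m.
Proof.
have p_gt0 : pairn m n == 0 = false by apply/negbTE; rewrite -lt0n muln_gt0 expn_gt0.
have hm k : k <= m -> iter k half (pairn m n) = 2 ^ (m - k) * n.*2.+1.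
  elim: k => [|k IH] km /=; first by rewrite subn0.
  by rewrite IH 1?ltnW // -(subnSK km) expnS -mulnA mul2n doubleK.
rewrite /fstn; case: ex_minnP => k; rewrite p_gt0 /= => Ho Hmin.
apply/eqP; rewrite eqn_leq Hmin /=; last by rewrite hm // subnn mul1n /= odd_double.
rewrite leqNgt; apply/negP => km; move: Ho.
by rewrite hm 1?ltnW // -(subnSK km) expnS -mulnA mul2n odd_double.
Qed.

Lemma sndn_pairn m n : sndn (pairn m n) = n.
Proof.
rewrite /sndn fstn_pairn; set q := n.*2.+1.
have -> : iter m half (pairn m n) = q.
  rewrite /pairn -/q; elim: m => [|m IH]; first by rewrite mul1n.
  by rewrite iterSr expnS -mulnA mul2n doubleK.
by rewrite /q /= uphalf_double.
Qed.

Lemma pairn_gt0 m n : 0 < pairn m n.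
Proof. by rewrite muln_gt0 expn_gt0. Qed.

Lemma rec1_min (f : nat -> nat -> bool) (f_reg : forall c, exists k, f k c) :
  rec2 (fun k c => f k c) -> rec1 (fun c => ex_minn (f_reg c)).
Proof.
move=> Hf.
pose F (v : 2.-tuple nat) : nat := ~~ f (thead v) (tnth v (inord 1)).
have HF : recursive F.
  apply: (rec_ext (rec_comp1 rec1_eq0 Hf)) => v.
  by rewrite /F; case: (f _ _).
have E k (v : 1.-tuple nat) : F [tuple of k :: v] = ~~ f k (thead v).
  by case/tupleP: v => c w; rewrite /F !theadE (tnth_nth 0) /= inordK.
have reg (v : 1.-tuple nat) : exists k, F [tuple of k :: v] == 0.
  by case: (f_reg (thead v)) => k Hk; exists k; rewrite E Hk.
apply: (rec_ext (rec_min reg HF)) => v.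
by apply: eq_ex_minn => k; rewrite E; case: (f _ _).
Qed.

Lemma rec1_fstn : rec1 fstn.
Proof.
apply: rec1_min.
have Hi : rec2 (fun k c => iter k half c).
  exact: rec2_iter rec1_id (rec21_comp rec1_half rec2_snd).
have H : rec2 (fun k p => (p == 0) + odd (iter k half p)).
  apply: rec2_comp rec2_add _ _; first exact: rec21_comp rec1_eq0 rec2_snd.
  exact: rec21_comp rec1_odd Hi.
apply: (rec_ext2 (rec21_comp rec1_eq0 (rec21_comp rec1_eq0 H))) => k p.
by case: (p == 0); case: (odd _).
Qed.

Lemma rec1_sndn : rec1 sndn.
Proof.
apply: rec11_comp rec1_half _.
apply: (rec12_comp (rec2_iter rec1_id (rec21_comp rec1_half rec2_snd)) rec1_fstn rec1_id).
Qed.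

(** * Computable functions between encoded types *)

(** [F] is unconstrained on numbers that encode nothing. In the rules below, [G] is the context of
    all free variables, and a function of further arguments is computable on pairs of a context and
    these arguments. *)
Definition computable (A B : Type) (eA : A -> nat) (eB : B -> nat) (f : A -> B) :=
  exists2 F, rec1 F & forall a, F (eA a) = eB (f a).

Definition enat (n : nat) : nat := n.
Definition epair (A B : Type) (eA : A -> nat) (eB : B -> nat) (p : A * B) : nat :=
  pairn (eA p.1) (eB p.2).
Definition eseq (A : Type) (eA : A -> nat) (s : seq A) : nat :=
  CodeSeq.code (map eA s).
Definition efin (T : finType) (x : T) : nat := enum_rank x.

Lemma epair_inj A B (eA : A -> nat) (eB : B -> nat) :
  injective eA -> injective eB -> injective (epair eA eB).
Proof.
move=> iA iB [a b] [a' b']; rewrite /epair /= => e.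
by congr (_, _); [apply: iA | apply: iB];
  [have := congr1 fstn e | have := congr1 sndn e]; rewrite ?fstn_pairn ?sndn_pairn.
Qed.

Lemma eseq_inj A (eA : A -> nat) : injective eA -> injective (eseq eA).
Proof. by move=> iA s s' /(can_inj CodeSeq.codeK) /(inj_map iA). Qed.

(** The code of a list can thus serve as the number of iterations of a loop that traverses the
    list. *)
Lemma size_eseq (A : Type) (eA : A -> nat) s : size s <= eseq eA s.
Proof.
elim: s => //= x s IH; rewrite -[eseq _ _]/(pairn (eA x) (eseq eA s)).
rewrite /pairn (leq_trans (n := (eseq eA s).*2.+1)) //; last by rewrite leq_pmull ?expn_gt0.
by rewrite ltnS (leq_trans IH) // -addnn leq_addr.
Qed.

Lemma efin_inj (T : finType) : injective (@efin T).
Proof. by move=> x y /val_inj /enum_rank_inj. Qed.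

Lemma nat_of_bool_inj : injective nat_of_bool.
Proof. by case; case. Qed.

Lemma rec1_if b f g : rec1 (fun n => nat_of_bool (b n)) -> rec1 f -> rec1 g ->
  rec1 (fun n => if b n then f n else g n).
Proof.
move=> Hb Hf Hg.
have Hnb := rec12_comp rec2_sub (rec1_const 1) Hb.
apply: (rec_ext1 (rec12_comp rec2_add (rec12_comp rec2_mul Hb Hf)
                   (rec12_comp rec2_mul Hnb Hg))) => n.
by case: (b n); rewrite ?mul1n ?mul0n ?addn0.
Qed.

Section Computable.
Variables (G A B : Type) (eG : G -> nat) (eA : A -> nat) (eB : B -> nat).

Lemma comp_id : computable eG eG id.
Proof. by exists id => //; apply: rec1_id. Qed.

Lemma comp_const b : computable eG eB (fun=> b).
Proof. by exists (fun=> eB b) => //; apply: rec1_const. Qed.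

Lemma comp_comp h f : computable eA eB h -> computable eG eA f ->
  computable eG eB (fun c => h (f c)).
Proof.
move=> [H rH eH] [F rF eF]; exists (fun n => H (F n)); first exact: rec11_comp.
by move=> c; rewrite eF eH.
Qed.

Lemma eq_computable f g : f =1 g -> computable eG eA f -> computable eG eA g.
Proof. by move=> e [F rF eF]; exists F => // c; rewrite eF e. Qed.

Lemma comp_pair f g : computable eG eA f -> computable eG eB g ->
  computable eG (epair eA eB) (fun c => (f c, g c)).
Proof.
move=> [F rF eF] [H rH eH]; exists (fun n => pairn (F n) (H n)).
  exact: rec12_comp rec2_pairn _ _.
by move=> c; rewrite eF eH.
Qed.

Lemma comp_fst f : computable eG (epair eA eB) f -> computable eG eA (fun c => (f c).1).
Proof.
move=> [F rF eF]; exists (fun n => fstn (F n)); first exact: rec11_comp rec1_fstn _.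
by move=> c; rewrite eF fstn_pairn.
Qed.

Lemma comp_snd f : computable eG (epair eA eB) f -> computable eG eB (fun c => (f c).2).
Proof.
move=> [F rF eF]; exists (fun n => sndn (F n)); first exact: rec11_comp rec1_sndn _.
by move=> c; rewrite eF sndn_pairn.
Qed.

Lemma comp_fin (T : finType) (h : T -> G -> B) (f : G -> T) :
  (forall t, computable eG eB (h t)) -> computable eG (@efin T) f ->
  computable eG eB (fun c => h (f c) c).
Proof.
move=> /fin_all_exists2 [H rH eH] [F rF eF].
pose K s n := foldr (fun t r => if F n == enum_rank t then H t n else r) 0 s.
exists (K (enum T)).
  elim: (enum T) => [|t s IH]; first exact: rec1_const.
  by apply: rec1_if => //; apply: rec12_comp rec2_eq rF (rec1_const _).
move=> c; have : f c \in enum T by rewrite mem_enum.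
elim: (enum T) => //= t s IH; rewrite inE eF.
case: (eqVneq (f c) t) => [<- _|ne /IH ->]; first by rewrite eqxx eH.
by case: eqP => // /efin_inj; move/eqP: ne.
Qed.

Lemma comp_if b f g : computable eG nat_of_bool b -> computable eG eA f ->
  computable eG eA g -> computable eG eA (fun c => if b c then f c else g c).
Proof.
move=> [K rK eK] [F rF eF] [H rH eH].
exists (fun n => if K n == 1 then F n else H n).
  by apply: rec1_if => //; apply: rec12_comp rec2_eq rK (rec1_const _).
by move=> c; rewrite eK eqb1 eF eH; case: (b c).
Qed.

Lemma comp_eqn f g : computable eG enat f -> computable eG enat g ->
  computable eG nat_of_bool (fun c => f c == g c).
Proof.
move=> [F rF eF] [H rH eH]; exists (fun n => F n == H n).
  exact: rec12_comp rec2_eq rF rH.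
by move=> c; rewrite eF eH.
Qed.

Lemma comp_enc f : computable eG eA f -> computable eG enat (fun c => eA (f c)).
Proof. by []. Qed.

Lemma comp_succ f : computable eG enat f -> computable eG enat (fun c => (f c).+1).
Proof.
move=> [F rF eF]; exists (fun n => (F n).+1); first exact: rec11_comp rec_succ _.
by move=> c; rewrite eF.
Qed.

Lemma comp_iter n b f : computable eG enat n -> computable eG eA b ->
  computable (epair eG eA) eA (fun p => f p.1 p.2) ->
  computable eG eA (fun c => iter (n c) (f c) (b c)).
Proof.
move=> [N rN eN] [K rK eK] [F rF eF].
have H := rec2_iter rK (rec21_comp rF rec2_pairn).
exists (fun m => iter (N m) (fun r => F (pairn m r)) (K m)).
  exact: rec12_comp H rN rec1_id.
move=> c; rewrite eN eK /enat; elim: (n c) => //= k ->.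
exact: (eF (c, _)).
Qed.

Lemma comp_foldl l b f : computable eG (eseq eA) l -> computable eG eB b ->
  computable (epair eG (epair eB eA)) eB (fun p => f p.1 p.2.1 p.2.2) ->
  computable eG eB (fun c => foldl (f c) (b c) (l c)).
Proof.
move=> [L rL eL] [K rK eK] [F rF eF].
(* A state of the loop is the accumulator paired with the code of the rest of the list. A state with
   empty rest is fixed, so iterating too often does no harm. *)
pose step q := let st := sndn q in let rest := sndn st in
  if rest == 0 then st
  else pairn (F (pairn (fstn q) (pairn (fstn st) (fstn rest)))) (sndn rest).
have rr := rec11_comp rec1_sndn rec1_sndn.
have rS : rec1 step.
  apply: rec1_if.
  - exact: rec12_comp rec2_eq rr (rec1_const _).
  - exact: rec1_sndn.
  apply: rec12_comp rec2_pairn _ (rec11_comp rec1_sndn rr).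
  apply: rec11_comp rF _; apply: rec12_comp rec2_pairn rec1_fstn _.
  apply: rec12_comp rec2_pairn (rec11_comp rec1_fstn rec1_sndn) _.
  exact: rec11_comp rec1_fstn rr.
have rI := rec2_iter (rec12_comp rec2_pairn rK rL) (rec21_comp rS rec2_pairn).
exists (fun m => fstn (iter (L m) (fun r => step (pairn m r)) (pairn (K m) (L m)))).
  exact: rec11_comp rec1_fstn (rec12_comp rI rL rec1_id).
move=> c; rewrite eL eK.
have stepE a s x : step (pairn (eG c) (pairn (eB a) (eseq eA (x :: s)))) =
    pairn (eB (f c a x)) (eseq eA s).
  rewrite -[eseq eA (x :: s)]/(pairn (eA x) (eseq eA s)) /step !(fstn_pairn, sndn_pairn).
  by rewrite eqn0Ngt pairn_gt0 -(eF (c, (a, x))).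
have step0 a : step (pairn (eG c) (pairn (eB a) 0)) = pairn (eB a) 0.
  by rewrite /step !(fstn_pairn, sndn_pairn).
have main s n a : size s <= n ->
    fstn (iter n (fun r => step (pairn (eG c) r)) (pairn (eB a) (eseq eA s))) =
    eB (foldl (f c) a s).
  elim: s n a => [|x s IH] n a.
    by elim: n => [|n IH] _; rewrite ?iterSr ?step0 ?IH //= fstn_pairn.
  by case: n => // n ns; rewrite iterSr stepE IH.
by apply: main; apply: size_eseq.
Qed.

Lemma comp_cons f g : computable eG eA f -> computable eG (eseq eA) g ->
  computable eG (eseq eA) (fun c => f c :: g c).
Proof.
move=> [F rF eF] [H rH eH]; exists (fun n => pairn (F n) (H n)).
  exact: rec12_comp rec2_pairn _ _.
by move=> c; rewrite eF eH.
Qed.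

Lemma comp_match l f0 f1 : computable eG (eseq eA) l -> computable eG eB f0 ->
  computable (epair eG (epair eA (eseq eA))) eB (fun p => f1 p.1 p.2.1 p.2.2) ->
  computable eG eB (fun c => if l c is a :: s then f1 c a s else f0 c).
Proof.
move=> [L rL eL] [F rF eF] [H rH eH].
exists (fun n => if L n == 0 then F n else H (pairn n (pairn (fstn (L n)) (sndn (L n))))).
  apply: rec1_if => //; first exact: rec12_comp rec2_eq rL (rec1_const _).
  apply: rec11_comp rH _; apply: rec12_comp rec2_pairn rec1_id _.
  exact: rec12_comp rec2_pairn (rec11_comp rec1_fstn rL) (rec11_comp rec1_sndn rL).
move=> c; rewrite eL; case: (l c) => [|a s]; first exact: eF.
rewrite -[eseq eA (a :: s)]/(pairn (eA a) (eseq eA s)).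
by rewrite eqn0Ngt pairn_gt0 fstn_pairn sndn_pairn -(eH (c, (a, s))).
Qed.

End Computable.

(* The least [k < n] with [P k], and [n] if there is none. *)
Definition search (P : nat -> bool) n := iter n (fun k => if P k then k else k.+1) 0.

Lemma searchP P n : search P n <= n /\ (forall k, k < search P n -> ~~ P k) /\
  (search P n < n -> P (search P n)).
Proof.
elim: n => [|n [IH1 [IH2 IH3]]] //=; rewrite -/(search P n).
case: ifP => p.
  by split; [exact: leqW | split].
split; first by rewrite ltnS.
split=> [k|]; last by rewrite ltnS => /IH3; rewrite p.
by rewrite ltnS leq_eqVlt => /predU1P[->|/IH2 //]; rewrite p.
Qed.

Lemma has_iota (P : nat -> bool) n : has P (iota 0 n) = ~~ (search P n == n).
Proof.
have [le [Hmin Hs]] := searchP P n; apply/hasP/idP => [[k]|ne].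
  rewrite mem_iota add0n /= => lt Pk; apply: contraTneq Pk => e.
  by apply: Hmin; rewrite e.
have lt : search P n < n by rewrite ltn_neqAle ne.
by exists (search P n); rewrite ?mem_iota //; apply: Hs.
Qed.

Section ComputableMore.
Variables (G A : Type) (eG : G -> nat) (eA : A -> nat).

Lemma comp_search P n : computable eG enat n ->
  computable (epair eG enat) nat_of_bool (fun p => P p.1 p.2) ->
  computable eG enat (fun c => search (P c) (n c)).
Proof.
move=> Hn HP; apply: comp_iter Hn (comp_const _ _ _) _.
apply: (comp_if HP); last apply: comp_succ; exact: comp_snd (comp_id _).
Qed.

Lemma comp_and f g : computable eG nat_of_bool f -> computable eG nat_of_bool g ->
  computable eG nat_of_bool (fun c => f c && g c).
Proof. move=> Hf Hg; exact: (comp_if Hf Hg (comp_const _ _ false)). Qed.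

Lemma comp_or f g : computable eG nat_of_bool f -> computable eG nat_of_bool g ->
  computable eG nat_of_bool (fun c => f c || g c).
Proof. move=> Hf Hg; exact: (comp_if Hf (comp_const _ _ true) Hg). Qed.

Lemma comp_neg f : computable eG nat_of_bool f -> computable eG nat_of_bool (fun c => ~~ f c).
Proof. move=> Hf; exact: (comp_if Hf (comp_const _ _ false) (comp_const _ _ true)). Qed.

Lemma comp_add f g : computable eG enat f -> computable eG enat g ->
  computable eG enat (fun c => f c + g c).
Proof.
move=> [F rF eF] [H rH eH]; exists (fun n => F n + H n); first exact: rec12_comp rec2_add _ _.
by move=> c; rewrite eF eH.
Qed.

Lemma comp_size l : computable eG (eseq eA) l -> computable eG enat (fun c => size (l c)).
Proof.
move=> Hl.
have H : computable eG enat (fun c => foldl (fun n _ => n.+1) 0 (l c)).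
  apply: (comp_foldl (f := fun _ n _ => n.+1) Hl (comp_const _ _ _)).
  exact: comp_succ (comp_fst (comp_snd (comp_id _))).
apply: eq_computable H => c; rewrite -[RHS]addn0.
by elim: (l c) 0 => //= _ s IH n; rewrite IH addnS.
Qed.

Lemma comp_rev l : computable eG (eseq eA) l -> computable eG (eseq eA) (fun c => rev (l c)).
Proof.
move=> Hl.
have H : computable eG (eseq eA) (fun c => foldl (fun s x => x :: s) [::] (l c)).
  apply: (comp_foldl (f := fun _ s x => x :: s) Hl (comp_const _ _ _)).
  apply: comp_cons; first exact: comp_snd (comp_snd (comp_id _)).
  exact: comp_fst (comp_snd (comp_id _)).
by apply: eq_computable H => c; rewrite /rev; elim: (l c) [::] => //= x s IH r; rewrite IH.
Qed.

End ComputableMore.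

Lemma comp_has G (eG : G -> nat) n P : computable eG enat n ->
  computable (epair eG enat) nat_of_bool (fun p => P p.1 p.2) ->
  computable eG nat_of_bool (fun c => has (P c) (iota 0 (n c))).
Proof.
move=> Hn HP; apply: (@eq_computable _ _ _ _ (fun c => ~~ (search (P c) (n c) == n c))).
  by move=> c; rewrite has_iota.
by apply: comp_neg; apply: comp_eqn => //; apply: comp_search.
Qed.

Lemma comp_cat G A (eG : G -> nat) (eA : A -> nat) s r : computable eG (eseq eA) s ->
  computable eG (eseq eA) r -> computable eG (eseq eA) (fun c => s c ++ r c).
Proof.
move=> Hs Hr; apply: (@eq_computable _ _ _ _ (fun c => foldl (fun q a => a ::
  q) (r c) (rev (s c)))).
  by move=> c; rewrite foldl_rev; elim: (s c) => //= a q ->.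
apply: (comp_foldl (f := fun _ q a => a :: q) (comp_rev Hs) Hr).
have i := comp_id (epair eG (epair (eseq eA) eA)).
exact: comp_cons (comp_snd (comp_snd i)) (comp_fst (comp_snd i)).
Qed.

(** A form of [take] composed of operations that are computable by the rules above. *)
Definition drop_last (T : Type) (k : nat) (s : seq T) : seq T := rev (iter k behead (rev s)).

Lemma drop_lastE T k (s : seq T) : drop_last k s = take (size s - k) s.
Proof.
rewrite /drop_last (_ : iter k behead (rev s) = drop k (rev s)); first by rewrite drop_rev revK.
elim: k (rev s) => [|k IH] r; first by rewrite drop0.
by rewrite iterSr IH; case: r.
Qed.

Lemma comp_drop_last G A (eG : G -> nat) (eA : A -> nat) k s : computable eG enat k ->
  computable eG (eseq eA) s -> computable eG (eseq eA) (fun c => drop_last (k c) (s c)).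
Proof.
move=> Hk Hs; apply: comp_rev; apply: (comp_iter (f := fun _ => behead) Hk (comp_rev Hs)).
have i := comp_id (epair eG (eseq eA)).
apply: (@eq_computable _ _ _ _ (fun p => if p.2 is _ :: r then r else [::])).
  by case=> c [].
apply: (comp_match (f1 := fun _ _ r => r) (comp_snd i) (comp_const _ _ _)).
exact: comp_snd (comp_snd (comp_id _)).
Qed.

(** * Free groups *)

Local Open Scope group_scope.

Arguments letter_inv : simpl never.
Arguments reduced : simpl never.

Section FreeGroup.
Variable Z : choiceType.
Implicit Types (x y s t : word Z) (a b : Z * bool) (g h : free_group Z).

Definition push a s : word Z :=
  if s is b :: s' then if b == letter_inv a then s' else a :: s else [:: a].

Definition red x : word Z := foldr push [::] x.

Lemma reduced_cons a x :
  reduced (a :: x) = (if x is b :: _ then b != letter_inv a else true) && reduced x.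
Proof. by case: x. Qed.

Lemma reduced_behead a x : reduced (a :: x) -> reduced x.
Proof. by rewrite reduced_cons => /andP[]. Qed.

Lemma push_reduced a s : reduced s -> reduced (push a s).
Proof.
case: s => [|b s] //= rs; case: eqP => [_|/eqP ne]; first exact: reduced_behead rs.
by rewrite reduced_cons ne.
Qed.

(** Every letter therefore permutes the reduced words, and inverse letters act by inverse
    permutations. *)
Lemma pushK a s : reduced s -> push (letter_inv a) (push a s) = s.
Proof.
case: s => [|b s] rs /=; first by rewrite letter_invK eqxx.
case: eqP rs => [->|/eqP ne] rs /=; last by rewrite letter_invK eqxx.
case: s rs => [|c s] //; rewrite reduced_cons letter_invK => /andP[/negbTE ne _].
by rewrite /= letter_invK ne.
Qed.

Lemma foldr_push_reduced s x : reduced s -> reduced (foldr push s x).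
Proof. by move=> rs; elim: x => //= a x; apply: push_reduced. Qed.

Lemma red_reduced x : reduced (red x).
Proof. exact: foldr_push_reduced. Qed.

Lemma red_id x : reduced x -> red x = x.
Proof.
elim: x => //= a x IH rx; rewrite IH; last exact: reduced_behead rx.
by move: rx; rewrite reduced_cons; case: x {IH} => //= b x /andP[/negbTE ->].
Qed.

Lemma foldr_push_inv s x : reduced s -> foldr push s (x ++ word_inv x) = s.
Proof.
elim: x s => //= a x IH s rs.
rewrite /word_inv /= rev_cons -cats1 catA foldr_cat IH /= ?push_reduced //.
by rewrite -{1}[a]letter_invK pushK.
Qed.

Lemma free_classM x y : free_class (x ++ y) = free_class x * free_class y.
Proof. by symmetry; apply: mclassM. Qed.

Lemma free_class1 : free_class [::] = 1 :> free_group Z.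
Proof. by []. Qed.

Lemma free_classV x : free_class (word_inv x) = (free_class x)^-1.
Proof.
apply: (@mulgI _ (free_class x)); rewrite mulgV -free_classM.
exact: free_mulgV.
Qed.

Lemma free_class_red x : free_class (red x) = free_class x.
Proof.
elim: x => //= a x IH; rewrite -[a :: x]cat1s free_classM -IH -free_classM.
case: (red x) => //= b s; case: eqP => // ->.
rewrite -[[:: a, letter_inv a & s]]/([:: a; letter_inv a] ++ s) free_classM.
suff -> : free_class [:: a; letter_inv a] = 1 by rewrite mul1g.
exact: (free_mulgV [:: a]).
Qed.

(** Van der Waerden's argument: the free group acts on reduced words. Evaluating the action at the
    empty word shows that the reduced form depends on the class only. *)
Lemma free_class_push x y : free_class x = free_class y ->
  forall s, reduced s -> foldr push s x = foldr push s y.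
Proof.
move/mclassP; elim=> {x y} [x y [a]|x|x y _ IH|y x z _ IH1 _ IH2|x x' y y' _ IH1 _ IH2] s rs //.
- exact: (@foldr_push_inv s [:: a]).
- by rewrite IH.
- by rewrite IH1 ?IH2.
by rewrite !foldr_cat IH2 // IH1 // foldr_push_reduced.
Qed.

Definition fword g : word Z := red (mquot_repr g).

Lemma fwordE x : fword (free_class x) = red x.
Proof. by apply: free_class_push => //; apply: mquot_reprK. Qed.

Lemma fwordK : cancel fword (@free_class Z).
Proof. by move=> g; rewrite /fword free_class_red; apply: mquot_reprK. Qed.

Lemma fword_reduced g : reduced (fword g). Proof. exact: red_reduced. Qed.

Lemma fword_inj : injective fword. Proof. exact: can_inj fwordK. Qed.

Lemma fwordM g h : fword (g * h) = foldr push (fword h) (fword g).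
Proof.
rewrite -{1}(fwordK g) -{1}(fwordK h) -free_classM fwordE /red foldr_cat.
by rewrite -/(red _) (red_id (fword_reduced h)).
Qed.

Definition len g := size (fword g).

Lemma size_push a s : size (push a s) <= (size s).+1.
Proof. by case: s => //= b s; case: eqP => // _; rewrite ltnW // ltnS leqnSn. Qed.

Lemma size_foldr_push s x : size (foldr push s x) <= size x + size s.
Proof. by elim: x => //= a x IH; apply: leq_trans (size_push _ _) _; rewrite ltnS. Qed.

Lemma len_mul g h : len (g * h) <= len g + len h.
Proof. by rewrite /len fwordM size_foldr_push. Qed.

Lemma len_class x : len (free_class x) <= size x.
Proof. by rewrite /len fwordE; apply: leq_trans (size_foldr_push _ _) _; rewrite addn0. Qed.

Lemma size_word_inv x : size (word_inv x) = size x.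
Proof. by rewrite /word_inv size_rev size_map. Qed.

Lemma len_inv g : len g^-1 = len g.
Proof.
have le h : len h^-1 <= len h.
  by rewrite -{1}(fwordK h) -free_classV; apply: leq_trans (len_class _) _; rewrite size_word_inv.
by apply/eqP; rewrite eqn_leq le -{1}[g]invgK le.
Qed.

Lemma size_push_ge a s : size s <= (size (push a s)).+1.
Proof. by case: s => //= b s; case: eqP => //= _; rewrite leqW // leqW. Qed.

Lemma size_foldr_push_ge s x : size s <= size x + size (foldr push s x).
Proof.
elim: x => //= a x IH; apply: leq_trans IH _.
by rewrite addSnnS leq_add2l size_push_ge.
Qed.

(** Each letter of [x] cancels at most one letter, so [x] is used up before the cancellation reaches
    [s]. *)
Lemma foldr_push_cat t s x : size x <= size t ->
  foldr push (t ++ s) x = foldr push t x ++ s.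
Proof.
elim: x => //= a x IH lt; rewrite IH 1?ltnW //.
have := size_foldr_push_ge t x; case: (foldr push t x) => [|b r] /=.
  by rewrite addn0 leqNgt lt.
by case: eqP.
Qed.

(** Being reduced concerns adjacent letters only, and two adjacent letters never straddle the
    nonempty overlap [s]. *)
Lemma reduced_glue x s y : s != [::] -> reduced (x ++ s) -> reduced (s ++ y) ->
  reduced (x ++ s ++ y).
Proof.
case: s => // a s _; elim: x => [|b x IH] //= rx ry.
have := reduced_behead rx => /IH /(_ ry) r.
move: rx; rewrite !reduced_cons r andbT => /andP[+ _].
by case: x {IH r}.
Qed.

Lemma reduced_catr x s : reduced (x ++ s) -> reduced s.
Proof. by elim: x => //= a x IH /reduced_behead. Qed.

Lemma reduced_rev x : reduced (rev x) = reduced x.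
Proof.
rewrite /reduced rev_sorted; apply: eq_sorted => a b.
by rewrite eq_sym (can2_eq (@letter_invK Z) (@letter_invK Z)).
Qed.

Lemma reduced_catl x s : reduced (x ++ s) -> reduced x.
Proof. by rewrite -reduced_rev rev_cat => /reduced_catr; rewrite reduced_rev. Qed.

Lemma reduced_inv x : reduced (word_inv x) = reduced x.
Proof.
rewrite /word_inv reduced_rev /reduced sorted_map; apply: eq_sorted => a b /=.
by rewrite (inj_eq (can_inj (@letter_invK Z))).
Qed.

(** Cyclic reduction: as long as the first and the last letter are inverse to each other, both are
    moved into the conjugator. Powers of [v] then become [z^-1 s^n z] without cancellation. *)
Lemma conj_decomp v : reduced v -> v != [::] ->
  exists z s, [/\ v = word_inv z ++ s ++ z, s != [::] & reduced (s ++ s)].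
Proof.
elim/ltn_ind: {v}(size v) {-2}v (erefl (size v)) => n IH v Ev rv vn.
case: v Ev rv vn => // a v Ev rv _.
case/lastP: v Ev rv => [|m b] Ev rv.
  exists [::], [:: a]; split => //; rewrite reduced_cons andbT.
  by case: a {rv Ev} => x []; apply/eqP; case.
case: (eqVneq b (letter_inv a)) => [Eb|ne]; last first.
  exists [::], (a :: rcons m b); rewrite cats0; split => //.
  rewrite -cats1 -cat_cons -catA; apply: reduced_glue; rewrite ?cats1 //=.
  rewrite reduced_cons rv andbT; apply: contraNneq ne => ->; by rewrite letter_invK.
have rm : reduced m by move: rv => /reduced_behead; rewrite -cats1 => /reduced_catl.
have mn : m != [::].
  by apply: contraTneq rv => ->; rewrite /= Eb reduced_cons eqxx.
have lm : size m < n by rewrite -Ev /= size_rcons.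
case: (IH _ lm m erefl rm mn) => z [s [Em sn rs]].
exists (rcons z b), s; split => //.
rewrite /word_inv map_rcons rev_rcons -/(word_inv z) Eb letter_invK /= Em -!cats1.
by rewrite !catA.
Qed.

Lemma expwS (s : word Z) n : s ^+ n.+1 = s ++ s ^+ n.
Proof. exact: expgS. Qed.

Lemma size_expw s n : size (s ^+ n) = (n * size s)%N.
Proof. by elim: n => [|n IH]; rewrite ?expwS ?size_cat ?IH. Qed.

Lemma reduced_pow s z y n : s != [::] -> reduced (s ++ s) -> reduced (y ++ s) -> reduced (s ++ z) ->
  reduced (y ++ s ^+ n.+1 ++ z).
Proof.
move=> sn rs ry rz; elim: n y ry => [|n IH] y ry; first by rewrite expg1 reduced_glue.
rewrite expwS -catA; apply: reduced_glue => //; exact: IH.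
Qed.

Lemma free_classX x n : free_class (x ^+ n) = free_class x ^+ n.
Proof. by elim: n => [|n IH] //; rewrite expwS free_classM IH expgS. Qed.

Lemma free_class_conj_pow z s n :
  free_class (word_inv z ++ s ++ z) ^+ n.+1 = free_class (word_inv z ++ s ^+ n.+1 ++ z).
Proof.
elim: n => [|n IH]; first by rewrite !expg1.
rewrite expgS IH !expwS !free_classM free_classV !mulgA.
by rewrite mulgK.
Qed.

(** With [v = z^-1 s z] cyclically reduced, the first [n] copies of [s] are longer than [g] and
    absorb all cancellation; the other copies survive literally. This periodic tail is what an
    automaton can pump. *)
Lemma fword_pow_tail v : reduced v -> v != [::] -> exists s z : word Z,
  s != [::] /\ forall g n, len g < n -> exists t, forall k,
    fword (g * free_class v ^+ (n + k)) = t ++ s ^+ k ++ z.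
Proof.
move=> rv vn; case: (conj_decomp rv vn) => z [s [Ev sn rs]].
have ry : reduced (word_inv z ++ s) by move: rv; rewrite Ev catA => /reduced_catl.
have rz : reduced (s ++ z) by move: rv; rewrite Ev => /reduced_catr.
have clE k := free_class_conj_pow z s k; rewrite -Ev in clE.
exists s, z; split=> // g [|n] // gn.
exists (foldr push (word_inv z ++ s ^+ n.+1) (fword g)) => k.
rewrite fwordM addSn clE fwordE red_id; last exact: reduced_pow.
have -> : word_inv z ++ s ^+ (n + k).+1 ++ z =
    (word_inv z ++ s ^+ n.+1) ++ s ^+ k ++ z.
  by rewrite -addSn expgnDr -!catA.
rewrite foldr_push_cat // size_cat size_expw; apply: leq_trans (leq_addl _ _).
apply: leq_trans (ltnW gn) _.
by rewrite leq_pmulr // lt0n size_eq0.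
Qed.

Lemma len_pow v n : reduced v -> v != [::] -> n <= len (free_class v ^+ n).
Proof.
move=> rv vn; case: n => // n; case: (conj_decomp rv vn) => z [s [Ev sn rs]].
have ry : reduced (word_inv z ++ s) by move: rv; rewrite Ev catA => /reduced_catl.
have rz : reduced (s ++ z) by move: rv; rewrite Ev => /reduced_catr.
have clE k := free_class_conj_pow z s k; rewrite -Ev in clE.
rewrite /len clE fwordE red_id; last exact: reduced_pow.
rewrite !size_cat size_expw addnCA; apply: leq_trans (leq_addr _ _).
by rewrite leq_pmulr // lt0n size_eq0.
Qed.

End FreeGroup.

(** * Cyclic subgroups and their cosets *)

Section OneRelatorWords.
Variables (Z : choiceType) (w : word Z).
Implicit Types x y : word Z.

Lemma Gp_eltM x y : Gp_elt w (x ++ y) = Gp_elt w x * Gp_elt w y.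
Proof. by rewrite /Gp_elt free_classM; symmetry; apply: mclassM. Qed.

Lemma Gp_elt_cons a x : Gp_elt w (a :: x) = Gp_elt w [:: a] * Gp_elt w x.
Proof. by rewrite -Gp_eltM. Qed.

Lemma Gp_elt1 : Gp_elt w [::] = 1. Proof. by []. Qed.

Lemma Gp_eltV x : Gp_elt w (word_inv x) = (Gp_elt w x)^-1.
Proof.
apply: (@mulgI _ (Gp_elt w x)); rewrite mulgV -Gp_eltM /Gp_elt free_classM free_classV.
by rewrite mulgV.
Qed.

Lemma Gp_elt_relator : Gp_elt w w = 1.
Proof. by apply/mclassP/cong_base. Qed.

Lemma Gp_elt_free x y : free_class x = free_class y -> Gp_elt w x = Gp_elt w y.
Proof. by rewrite /Gp_elt => ->. Qed.

(** Undoes both quotients at once, so that invariants of the group can be verified on words: a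
    multiplicative equivalence need only contain the cancellations and the relator. *)
Lemma Gp_elt_ind (E : word Z -> word Z -> Prop) :
    (forall x, E x x) -> (forall x y, E x y -> E y x) ->
    (forall y x z, E x y -> E y z -> E x z) ->
    (forall x x' y y', E x x' -> E y y' -> E (x ++ y) (x' ++ y')) ->
    (forall a, E [:: a; letter_inv a] [::]) -> E w [::] ->
  forall x y, Gp_elt w x = Gp_elt w y -> E x y.
Proof.
move=> Er Es Et Em Ec Ew.
have Ef x y : free_class x = free_class y -> E x y.
  move/mclassP; elim=> {x y} [x y [a]|x|x y _|y x z _ IH1 _ IH2|x x' y y' _ IH1 _ IH2] //.
  - exact: Es.
  - exact: Et IH1 IH2.
  exact: (Em _ _ _ _ IH1 IH2).
move=> x y /mclassP; move Eg: (free_class x) => g; move Eh: (free_class y) => h C.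
elim: C x y Eg Eh => {g h} [g h [-> ->] x y /Ef Ex Ey|g x y <- /Ef/Es //|g h _ IH x y Ex Ey|
  h g k _ IH1 _ IH2 x y Ex Ey|g g' h h' _ IH1 _ IH2 x y Ex Ey].
- apply: Et Ex (Et _ _ _ Ew _); exact: Ef.
- by apply: Es; apply: IH.
- by apply: (Et (fword h)); [apply: IH1|apply: IH2]; rewrite ?fwordK.
apply: (Et (fword g ++ fword h)); first by apply: Ef; rewrite free_classM !fwordK.
apply: (Et (fword g' ++ fword h')); last by apply: Ef; rewrite free_classM !fwordK.
by apply: Em; [apply: IH1|apply: IH2]; rewrite fwordK.
Qed.

End OneRelatorWords.

Section ZExp.
Variable H : groupType.
Implicit Types c d h : H.

(** The power of [c] with the integer exponent [m - n]; a pair of naturals plays the role of an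
    integer throughout. *)
Definition zexp c m n := c ^+ m / c ^+ n.

Lemma zexp_commute c m n : c ^+ m * c ^+ n = c ^+ n * c ^+ m.
Proof. by rewrite -!expgnDr addnC. Qed.

Lemma zexp_commuteV c m n : c ^+ m / c ^+ n = (c ^+ n)^-1 * c ^+ m.
Proof. by apply: (@mulgI _ (c ^+ n)); rewrite mulVKg mulgA zexp_commute mulgK. Qed.

Lemma zexpD c m n p q : zexp c m n * zexp c p q = zexp c (m + p) (n + q).
Proof.
rewrite /zexp (zexp_commuteV c p) mulgA -(mulgA (c ^+ m)) -invgM -expgnDr.
by rewrite (zexp_commuteV c m) -mulgA -expgnDr -zexp_commuteV (addnC q).
Qed.

Lemma zexpV c m n : (zexp c m n)^-1 = zexp c n m.
Proof. by rewrite /zexp invgM invgK. Qed.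

Lemma zexp0 c : zexp c 0 0 = 1. Proof. exact: mulgV. Qed.

Lemma zexpn0 c n : zexp c n 0 = c ^+ n.
Proof. by rewrite /zexp invg1 mulg1. Qed.

Lemma zexp0n c n : zexp c 0 n = c ^- n.
Proof. by rewrite /zexp mul1g. Qed.

Lemma zexp1 c : zexp c 1 0 = c. Proof. by rewrite zexpn0. Qed.

Lemma zexpSr c m n : zexp c m n * c = zexp c m.+1 n.
Proof. by rewrite -{2}(zexp1 c) zexpD addn1 addn0. Qed.

Lemma zexpDl c m n k : zexp c (m + k) (n + k) = zexp c m n.
Proof. by rewrite -zexpD /zexp mulgV mulg1. Qed.

Lemma zexpE c m n : zexp c m n = if n <= m then c ^+ (m - n) else c ^- (n - m).
Proof.
case: leqP => le; last rewrite -zexp0n; first rewrite -zexpn0.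
  by rewrite -(zexpDl c (m - n) 0 n) subnK.
by rewrite -(zexpDl c 0 (n - m) m) subnK // ltnW.
Qed.

Lemma zexp_congr c m n p q : (m + q = p + n)%N -> zexp c m n = zexp c p q.
Proof. by move=> E; rewrite -(zexpDl c m n q) E (addnC n) zexpDl. Qed.

Lemma zexp_cases c m n : exists k, zexp c m n = c ^+ k \/ zexp c m n = c ^- k.
Proof. by rewrite zexpE; case: leqP => _; eexists; [left|right]. Qed.

Definition cyc c h := exists m n, h = zexp c m n.

Lemma cycM c g h : cyc c g -> cyc c h -> cyc c (g * h).
Proof. by case=> m [n ->] [p [q ->]]; rewrite zexpD; do 2 eexists. Qed.

Lemma cycV c h : cyc c h -> cyc c h^-1.
Proof. by case=> m [n ->]; rewrite zexpV; do 2 eexists. Qed.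

Lemma cyc1 c : cyc c 1. Proof. by exists 0, 0; rewrite zexp0. Qed.

Lemma cycg c : cyc c c. Proof. by exists 1%N, 0; rewrite zexp1. Qed.

End ZExp.

Section Cosets.
Variable X : finType.
Implicit Types (c d h : free_group X).

Definition enc h : nat := word_code (fword h).

Lemma word_code_inj (Z : finType) : injective (@word_code Z).
Proof. exact: (eseq_inj (@efin_inj _)). Qed.

Lemma enc_inj : injective enc.
Proof. by move=> g h /word_code_inj/fword_inj. Qed.

Lemma len_enc h : len h <= enc h. Proof. exact: size_eseq. Qed.

(* It makes [c] of infinite order and bounds the searches for exponents below. *)
Definition unbounded c := forall n, n <= len (c ^+ n).

(* Meaningful only if [h] is a power of [c] or of its inverse. *)
Definition zlog c h := search (fun k => (c ^+ k == h) || (c ^- k == h)) (len h).+1.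

(** The homomorphism from [<c>] that sends [c] to [d]: [zlog] yields the absolute value of the
    exponent, and the test recovers its sign. *)
Definition phi c d h := if c ^+ zlog c h == h then d ^+ zlog c h else d ^- zlog c h.

(** Origin of the bound: if [h c^k] has a code at most [enc h], its length is at most [enc h], hence
    [|k| <= len (c^k) <= len h + enc h] when [c] is unbounded. The search misses no candidate. *)
Definition rep_code c h := search (fun n => has (fun k =>
  (enc (h * c ^+ k) == n) || (enc (h * c ^- k) == n)) (iota 0 (len h + enc h).+1)) (enc h).

Definition rep_exp c h := search (fun k =>
  (enc (h * c ^+ k) == rep_code c h) || (enc (h * c ^- k) == rep_code c h)) (len h + enc h).+1.

(* The element of the coset [h * <c>] of least code *)
Definition rep c h := let k := rep_exp c h in
  if enc (h * c ^+ k) == rep_code c h then h * c ^+ k else h * c ^- k.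

Section Unbounded.
Variables c d : free_group X.
Hypothesis c_unbounded : unbounded c.

Lemma expg_eq1 n : c ^+ n = 1 -> n = 0.
Proof. by move=> e; have := c_unbounded n; rewrite e /len fwordE leqn0 => /eqP. Qed.

Lemma zexp_eq m n p q : zexp c m n = zexp c p q -> (m + q = p + n)%N.
Proof.
move=> e; have : zexp c (m + q) (n + p) = 1.
  by rewrite -zexpD e zexpD addnC (addnC q) zexpE leqnn subnn.
rewrite zexpE; case: leqP => le; last first.
  by move/(congr1 inv); rewrite invgK invg1 => /expg_eq1/eqP; rewrite subn_eq0 leqNgt le.
move/expg_eq1/eqP; rewrite subn_eq0 => le'.
by apply/eqP; rewrite (addnC p) eqn_leq le le'.
Qed.

(** Subtraction is truncated, so the right-hand side is the absolute value of [m - n]. *)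
Lemma zlogP m n : zlog c (zexp c m n) = ((m - n) + (n - m))%N.
Proof.
have [_ [Hmin Hs]] := searchP (fun k => (c ^+ k == zexp c m n) || (c ^- k == zexp c m n))
  (len (zexp c m n)).+1.
rewrite -/(zlog c _) in Hmin Hs.
have uniq k : (c ^+ k == zexp c m n) || (c ^- k == zexp c m n) -> k = ((m - n) + (n - m))%N.
  case/orP=> /eqP; [rewrite -zexpn0 | rewrite -zexp0n] => /zexp_eq;
    rewrite ?add0n ?addn0 => e.
    by rewrite -e addnK (eqP (_ : n - (k + n) == 0)%N) ?addn0 // subn_eq0 leq_addl.
  by rewrite e addKn (eqP (_ : m - (m + k) == 0)%N) // subn_eq0 leq_addr.
apply: uniq; apply: Hs; rewrite ltnNge; apply/negP => ge.
have := zexpE c m n; case: leqP => le e.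
  have lt : m - n < zlog c (zexp c m n) by apply: leq_trans ge; rewrite ltnS e.
  by have := Hmin _ lt; rewrite e eqxx.
have lt : n - m < zlog c (zexp c m n) by apply: leq_trans ge; rewrite ltnS e len_inv.
by have := Hmin _ lt; rewrite e eqxx orbT.
Qed.

Lemma phi_zexp m n : phi c d (zexp c m n) = zexp d m n.
Proof.
rewrite /phi zlogP zexpE (zexpE d); case: (leqP n m) => le.
  by rewrite (eqP (_ : n - m == 0)%N) ?subn_eq0 // addn0 eqxx.
rewrite (eqP (_ : m - n == 0)%N) ?subn_eq0 1?ltnW // add0n; case: eqP => // e.
have /zexp_eq/eqP : zexp c (n - m) 0 = zexp c 0 (n - m) by rewrite zexpn0 zexp0n.
rewrite addn_eq0 => /andP[/eqP ->].
by rewrite expg0 invg1.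
Qed.

Lemma phi_cyc h : cyc c h -> cyc d (phi c d h).
Proof. by case=> m [n ->]; rewrite phi_zexp; do 2 eexists. Qed.

Lemma phi_mul h : cyc c h -> phi c d (h * c) = phi c d h * d.
Proof.
by case=> m [n ->]; rewrite zexpSr !phi_zexp zexpSr.
Qed.

Lemma rep_codeP h :
  (exists2 k, k < (len h + enc h).+1 &
    (enc (h * c ^+ k) == rep_code c h) || (enc (h * c ^- k) == rep_code c h)) /\
  (forall d, cyc c d -> rep_code c h <= enc (h * d)).
Proof.
pose P n := has (fun k =>
  (enc (h * c ^+ k) == n) || (enc (h * c ^- k) == n)) (iota 0 (len h + enc h).+1).
have [Hle [Hmin Hs]] := searchP P (enc h).
rewrite -/(rep_code c h) in Hle Hmin Hs.
have Pex : P (rep_code c h).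
  move: Hle; rewrite leq_eqVlt => /predU1P[->|/Hs //].
  by apply/hasP; exists 0; rewrite ?mem_iota // mulg1 eqxx.
split; first by case/hasP: Pex => k; rewrite mem_iota => Hk; exists k.
move=> _ [m [n ->]]; case: (leqP (enc h) (enc (h * zexp c m n))) => [|lt]; first exact: leq_trans.
rewrite leqNgt; apply/negP => /Hmin /hasPn.
have [k Ek] := zexp_cases c m n.
have kle : k < (len h + enc h).+1.
  have : k <= len (zexp c m n) by case: Ek => ->; rewrite ?len_inv; apply: c_unbounded.
  move/leq_trans; apply; rewrite -[zexp c m n](mulKg h); apply: leq_trans (len_mul _ _) _.
  by rewrite len_inv leq_add2l (leq_trans (len_enc _)) // ltnW.
move/(_ k); rewrite mem_iota /= add0n kle => /(_ isT) /negP; apply.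
by case: Ek => ->; rewrite eqxx ?orbT.
Qed.

Lemma repP h : cyc c (h^-1 * rep c h) /\ enc (rep c h) = rep_code c h.
Proof.
have [[k0 lt Hk] _] := rep_codeP h.
pose P k := (enc (h * c ^+ k) == rep_code c h) || (enc (h * c ^- k) == rep_code c h).
have [_ [Hmin Hs]] := searchP P (len h + enc h).+1.
rewrite -/(rep_exp c h) in Hmin Hs.
have Pk : P (rep_exp c h).
  apply: Hs; apply: leq_ltn_trans lt; rewrite leqNgt; apply/negP => /Hmin.
  by rewrite /P Hk.
rewrite /rep; case: eqP Pk => [e _|ne /orP[/eqP//|/eqP e]].
  by rewrite mulKg; split=> //; exists (rep_exp c h), 0; rewrite zexpn0.
by rewrite mulKg; split=> //; exists 0, (rep_exp c h); rewrite zexp0n.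
Qed.

Lemma rep_cyc h : cyc c ((rep c h)^-1 * h).
Proof. by have [/cycV] := repP h; rewrite invgM invgK. Qed.

Lemma rep_mul h g : cyc c g -> rep c (h * g) = rep c h.
Proof.
have le h1 h2 : cyc c (h1^-1 * h2) -> rep_code c h1 <= rep_code c h2.
  move=> C; have [_ /(_ (h1^-1 * rep c h2))] := rep_codeP h1.
  rewrite mulVKg (repP h2).2; apply.
  by rewrite -(mulVKg h2 (rep c h2)) mulgA; apply: cycM => //; case: (repP h2).
move=> C; apply: enc_inj; rewrite !(repP _).2; apply/eqP; rewrite eqn_leq.
by rewrite !le // ?mulKg // invgM -mulgA mulVg mulg1; apply: cycV.
Qed.

Lemma rep_rep h : rep c (rep c h) = rep c h.
Proof. by rewrite -{2}(mulVKg (rep c h) h) rep_mul //; apply: rep_cyc. Qed.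

Lemma enc1 : enc 1 = 0. Proof. by rewrite /enc fwordE. Qed.

Lemma rep1 g : cyc c g -> rep c g = 1.
Proof.
move=> C; rewrite -[g]mul1g rep_mul //; apply: enc_inj.
have [_ /(_ 1 (cyc1 _))] := rep_codeP 1.
by rewrite (repP 1).2 mulg1 enc1 leqn0 => /eqP.
Qed.

End Unbounded.
End Cosets.

(** * Normal forms in the HNN extension *)

Section HNN.
Variables (X : finType) (u v : word X).
Hypotheses (u_neq_nil : u != [::]) (v_neq_nil : v != [::]).
Hypotheses (u_reduced : reduced u) (v_reduced : reduced v).

Definition relator : word (option X) :=
  let t : word (option X) := [:: (None, false)] in
  t^-1 * map_word Some u * t * (map_word Some v)^-1.

Definition tletter (e : bool) : option X * bool := (None, e).

Lemma relatorE : relator =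
  [:: tletter true] ++ map_word Some u ++ [:: tletter false] ++ word_inv (map_word Some v).
Proof.
rewrite /relator -[_ * _]/(([:: tletter true] ++ map_word Some u ++ [:: tletter false])
  ++ word_inv (map_word Some v)).
by rewrite /= -catA.
Qed.

Notation H := (free_group X).

(* [assoc e * t^e = t^e * assoc (~~ e)], where [t^true] is the inverse of [t]. *)
Definition assoc (e : bool) : H := free_class (if e then v else u).

Lemma assoc_unbounded e : unbounded (assoc e).
Proof. by move=> n; apply: len_pow; case: e. Qed.

Definition crep e (h : H) : H := rep (assoc e) h.
Definition slide e (h : H) : H := phi (assoc e) (assoc (~~ e)) h.

Lemma slide_mul e h : cyc (assoc e) h -> slide e (h * assoc e) = slide e h * assoc (~~ e).
Proof. by move=> C; apply: phi_mul => //; apply: assoc_unbounded. Qed.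

Lemma slide_cyc e h : cyc (assoc e) h -> cyc (assoc (~~ e)) (slide e h).
Proof. by move=> C; apply: phi_cyc => //; apply: assoc_unbounded. Qed.

Lemma slideK e h : cyc (assoc e) h -> slide (~~ e) (slide e h) = h.
Proof.
move=> [m [n ->]]; rewrite /slide negbK phi_zexp; last exact: assoc_unbounded.
by rewrite phi_zexp //; apply: assoc_unbounded.
Qed.

(* [(h, [:: (e_n, r_n); ...; (e_1, r_1)])] stands for [r_1 t^e_1 ... r_n t^e_n h]. *)
Definition state : Type := H * seq (bool * H).
Implicit Type st : state.

(** The argument [r] will be the coset representative of the current free part, so [r == 1] says
    that this part lies in the associated subgroup, as in Britton's lemma. *)
Definition pinch (e : bool) (r : H) (s : seq (bool * H)) : bool :=
  if s is p :: _ then (p.1 == ~~ e) && (r == 1) else false.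

(** Right multiplication of a normal form by [t^e]: the free part is [r c] with [c] in the
    associated subgroup, and [c] slides across [t^e]. At a pinch, [t^e] cancels the last stable
    letter and the slid power joins the free part below. *)
Definition stepT (e : bool) st : state :=
  let r := crep e st.1 in
  let d := slide e (r^-1 * st.1) in
  if pinch e r st.2 then ((head (e, 1) st.2).2 * d, behead st.2) else (d, (e, r) :: st.2).

Definition step st (a : option X * bool) : state :=
  if a.1 is Some x then (st.1 * free_class [:: (x, a.2)], st.2) else stepT a.2 st.

Definition act st (x : word (option X)) : state := foldl step st x.

Fixpoint valid (s : seq (bool * H)) : bool :=
  if s is p :: s' then [&& crep p.1 p.2 == p.2, ~~ pinch p.1 p.2 s' & valid s'] else true.

Lemma crep_cyc e h : cyc (assoc e) ((crep e h)^-1 * h).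
Proof. by apply: rep_cyc; apply: assoc_unbounded. Qed.

Lemma crep_mul e h g : cyc (assoc e) g -> crep e (h * g) = crep e h.
Proof. by apply: rep_mul; apply: assoc_unbounded. Qed.

Lemma crep1 e g : cyc (assoc e) g -> crep e g = 1.
Proof. by apply: rep1; apply: assoc_unbounded. Qed.

Lemma stepT_valid e st : valid st.2 -> valid (stepT e st).2.
Proof.
case: st => h s; rewrite /stepT /=; case: ifP => [_|np] /=.
  by case: s => //= p s /and3P[].
move=> ->; rewrite np /= andbT; apply/eqP.
by apply: rep_rep; apply: assoc_unbounded.
Qed.

(** After a pinch, the exposed [r'] is a representative and validity excludes a second pinch, so the
    reverse step pushes the removed letter again. Without a pinch, the new free part lies in the
    associated subgroup, so the reverse step does pinch. *)
Lemma stepTK e st : valid st.2 -> stepT (~~ e) (stepT e st) = st.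
Proof.
case: st => h s; rewrite /stepT /=; have C := crep_cyc e h.
move=> vs; case pc: (pinch e (crep e h) s) => /=.
  case: s vs pc => //= -[e' r'] s /= /and3P[/eqP rr np vs] /andP[/eqP Ee' /eqP r1].
  move: np rr; rewrite {}Ee' {e'} => np rr.
  rewrite r1 invg1 mul1g in C *; rewrite crep_mul ?rr; last exact: slide_cyc.
  by rewrite mulKg slideK // (negbTE np).
rewrite crep1; last exact: slide_cyc.
by rewrite negbK !eqxx /= invg1 mul1g slideK // mulVKg.
Qed.

(** A factor [assoc e] changes neither the coset representative nor the pinch test; it only slides
    along. This is the defining relation of the extension, read in the action. *)
Lemma stepT_assoc e h s : stepT e (h * assoc e, s) =
  ((stepT e (h, s)).1 * assoc (~~ e), (stepT e (h, s)).2).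
Proof.
rewrite /stepT /= crep_mul; last exact: cycg.
by rewrite mulgA slide_mul; last exact: crep_cyc; case: ifP => _ /=; rewrite ?mulgA.
Qed.

Lemma act_cat st x y : act st (x ++ y) = act (act st x) y.
Proof. exact: foldl_cat. Qed.

Lemma act_embed st (x : word X) :
  act st (map_word Some x) = (st.1 * free_class x, st.2).
Proof.
elim: x st => [|[z b] x IH] [h s]; rewrite /act /=; first by rewrite mulg1.
by rewrite -/(act _ _) IH /= -mulgA -free_classM.
Qed.

Lemma act_valid st x : valid st.2 -> valid (act st x).2.
Proof.
elim: x st => //= [[[z|] b]] x IH st vs; apply: IH => //; exact: stepT_valid.
Qed.

Lemma map_word_inv (x : word X) :
  map_word (@Some X) (word_inv x) = word_inv (map_word Some x).
Proof. by rewrite /word_inv /map_word map_rev -!map_comp. Qed.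

Lemma act_relator st : valid st.2 -> act st relator = st.
Proof.
case: st => h s vs; rewrite relatorE -map_word_inv !act_cat act_embed act_embed.
have -> : act (h, s) [:: tletter true] = stepT true (h, s) by [].
(* Acting by [t^-1] and then [u] is acting by [v] and then [t^-1], which the next letter [t]
   undoes. *)
rewrite -[free_class u]/(assoc (~~ true)) -stepT_assoc.
have -> st : act st [:: tletter false] = stepT (~~ true) st by [].
by rewrite stepTK //= free_classV mulgK.
Qed.

Lemma act_cancel st a : valid st.2 -> act st [:: a; letter_inv a] = st.
Proof.
case: a => [[z|] b] vs; last exact: stepTK.
case: st vs => h s vs.
by have := act_embed (h, s) [:: (z, b); (z, ~~ b)];
  rewrite (free_mulgV [:: (z, b)]) mulg1.
Qed.

(** The group acts on valid states. Applied to the initial state, this makes the normal form an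
    invariant of the group element without recourse to Britton's lemma. *)
Lemma act_Gp x y : Gp_elt relator x = Gp_elt relator y ->
  forall st, valid st.2 -> act st x = act st y.
Proof.
apply: (@Gp_elt_ind _ _ (fun x y => forall st, valid st.2 -> act st x = act st y)) => {x y}.
- by [].
- by move=> x y E st /E.
- by move=> y x z E1 E2 st vs; rewrite E1 ?E2.
- by move=> x x' y y' E1 E2 st vs; rewrite !act_cat E1 // E2 //; apply: act_valid.
- by move=> a st vs; apply: act_cancel.
by move=> st vs; apply: act_relator.
Qed.

Definition embed (h : H) : Gp relator := Gp_elt relator (map_word Some (fword h)).
Definition stable e : Gp relator := Gp_elt relator [:: tletter e].

Lemma map_word_cat (x y : word X) :
  map_word (@Some X) (x ++ y) = map_word Some x ++ map_word Some y.
Proof. exact: map_cat. Qed.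

Lemma embed_class x : embed (free_class x) = Gp_elt relator (map_word Some x).
Proof.
rewrite /embed fwordE.
have push_embed a s : Gp_elt relator (map_word Some (push a s)) =
    Gp_elt relator (map_word Some (a :: s)).
  case: s => //= b s; case: eqP => // ->.
  apply: Gp_elt_free; set A : word (option X) := [:: (Some a.1, a.2)].
  rewrite -[X in _ = free_class X]/((A ++ word_inv A) ++ map_word Some s) free_classM.
  by rewrite (free_mulgV A : free_class (A ++ word_inv A) = 1) mul1g.
elim: x => // a x IH; rewrite [red _]/= push_embed.
by rewrite [LHS]Gp_elt_cons [RHS]Gp_elt_cons IH.
Qed.

Lemma embedM g h : embed (g * h) = embed g * embed h.
Proof.
by rewrite -{1}(fwordK g) -{1}(fwordK h) -free_classM embed_class map_word_cat Gp_eltM.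
Qed.

Lemma embed1 : embed 1 = 1. Proof. by rewrite -free_class1 embed_class. Qed.

Lemma embedV h : embed h^-1 = (embed h)^-1.
Proof. by apply: (@mulgI _ (embed h)); rewrite -embedM !mulgV embed1. Qed.

Lemma stableV e : stable e * stable (~~ e) = 1.
Proof. rewrite /stable -Gp_eltM; exact: (Gp_elt_free relator (free_mulgV [:: tletter e])). Qed.

Lemma stable_inv e : stable e = (stable (~~ e))^-1.
Proof. by apply: (@mulIg _ (stable (~~ e))); rewrite stableV mulVg. Qed.

Lemma assoc_stable e : embed (assoc e) * stable e = stable e * embed (assoc (~~ e)).
Proof.
have R : stable true * embed (assoc false) * stable false = embed (assoc true).
  apply: divg1_eq; rewrite -embedV -free_classV !embed_class map_word_inv /stable -!Gp_eltM.
  by rewrite -(Gp_elt_relator relator) relatorE /= -!catA.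
case: e; first by rewrite -R -!mulgA stableV mulg1.
by rewrite -R !mulgA stableV mul1g.
Qed.

Lemma zexp_stable e m n : embed (zexp (assoc e) m n) * stable e =
  stable e * embed (zexp (assoc (~~ e)) m n).
Proof.
have S k : embed (assoc e ^+ k) * stable e = stable e * embed (assoc (~~ e) ^+ k).
  elim: k => [|k IH]; first by rewrite !expg0 embed1 mul1g mulg1.
  by rewrite !expgSr !embedM -mulgA assoc_stable mulgA IH mulgA.
rewrite /zexp !embedM !embedV -mulgA.
have -> : (embed (assoc e ^+ n))^-1 * stable e = stable e / embed (assoc (~~ e) ^+ n).
  by apply: (@mulgI _ (embed (assoc e ^+ n))); rewrite mulVKg mulgA S mulgK.
by rewrite mulgA S mulgA.
Qed.

Lemma slide_stable e h : cyc (assoc e) h -> embed h * stable e = stable e * embed (slide e h).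
Proof.
by case=> m [n ->]; rewrite /slide phi_zexp ?zexp_stable //; apply: assoc_unbounded.
Qed.

Fixpoint gstack (s : seq (bool * H)) : Gp relator :=
  if s is p :: s' then gstack s' * embed p.2 * stable p.1 else 1.

Definition gstate st := gstack st.2 * embed st.1.

Lemma gstate_stepT e st : gstate (stepT e st) = gstate st * stable e.
Proof.
case: st => h s; rewrite /gstate /stepT /=; have C := crep_cyc e h.
have E : embed h * stable e = embed (crep e h) * stable e * embed (slide e ((crep e h)^-1 * h)).
  by rewrite -mulgA -slide_stable // mulgA -embedM mulVKg.
case: ifP => [|_] /=; last by rewrite -!mulgA E -!mulgA.
case: s => //= -[e' r'] s /= /andP[/eqP -> /eqP r1].
rewrite -mulgA E r1 embed1 mul1g embedM !mulgA; congr (_ * _).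
by rewrite -!mulgA -{2}[e]negbK stableV mulg1.
Qed.

Lemma gstate_act st x : gstate (act st x) = gstate st * Gp_elt relator x.
Proof.
elim: x st => [|[[z|] b] x IH] [h s]; first by rewrite Gp_elt1 mulg1.
  rewrite -[act _ _]/(act (h * free_class [:: (z, b)], s) x) IH Gp_elt_cons.
  by rewrite /gstate /= embedM embed_class !mulgA.
by rewrite -[act _ _]/(act (stepT b (h, s)) x) IH Gp_elt_cons mulgA gstate_stepT.
Qed.

Definition init : state := (1, [::]).
Definition nf x := act init x.

Lemma gstate_nf x : gstate (nf x) = Gp_elt relator x.
Proof. by rewrite gstate_act /gstate /= embed1 !mul1g. Qed.

Lemma nf_eq x y : nf x = nf y <-> Gp_elt relator x = Gp_elt relator y.
Proof.
split=> [E|E]; first by rewrite -!gstate_nf E.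
exact: act_Gp.
Qed.

End HNN.

(** * The prefix monoid on normal forms *)

Lemma prefix_cat_cases (T : eqType) (q A B : seq T) : prefix q (A ++ B) ->
  prefix q A \/ exists2 q', prefix q' B & q = A ++ q'.
Proof.
rewrite prefixE take_cat => /eqP; case: ltnP => _ Eq; first by left; rewrite prefixE Eq.
by right; exists (take (size q - size A) B); rewrite ?Eq ?prefix_take // prefix_take.
Qed.

Lemma prefix_take_eq (T : eqType) (q s : seq T) : prefix q s -> q = take (size q) s.
Proof. by rewrite prefixE => /eqP. Qed.

Section PrefixMonoid.
Variables (X : finType) (u v : word X).
Hypotheses (u_neq_nil : u != [::]) (v_neq_nil : v != [::]).
Hypotheses (u_reduced : reduced u) (v_reduced : reduced v).
Notation H := (free_group X).
Notation w := (relator u v).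
Notation assoc := (assoc u v).
Notation embed := (embed u v).
Notation stable := (stable u v).

Definition Qv : H -> Prop :=
  submonoid_gen (fun h => exists2 q, prefix q v & h = free_class q).

Definition Nu (h : H) : Prop := exists p, exists2 q, prefix p u & Qv q /\ h = free_class p * q.

(** The exponent [m - n] is the [k] of the topmost stable letter: [r t^-1 h] is rewritten as
    [r v^k t^-1 u^-k h], whose left part is tested against the rest of the stack. *)
Fixpoint stack_mem (s : seq (bool * H)) (h : H) : Prop :=
  if s is p :: s' then p.1 /\ exists m n : nat,
    stack_mem s' (p.2 * zexp (assoc true) m n) /\ Nu (zexp (assoc false) n m * h)
  else Qv h.

Lemma stack_mem_Qv s h g : stack_mem s h -> Qv g -> stack_mem s (h * g).
Proof.
case: s => [|p s] /=; first by apply: gen_mul.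
case=> -> [m [n [I [q [x pq [Qx E]]]]]] Qg; split=> //; exists m, n; split=> //.
exists q, (x * g) => //; split; first exact: gen_mul.
by rewrite mulgA E mulgA.
Qed.

Lemma prefix_monoid_t (p : word X) : prefix p u ->
  prefix_monoid (stable true * embed (free_class p) : Gp w).
Proof.
move=> pu; apply: gen_base; exists ([:: tletter X true] ++ map_word Some p).
  rewrite relatorE; apply/prefixP; exists (map_word Some (drop (size p) u) ++ [:: tletter X false]
    ++
    word_inv (map_word Some v)).
  have E : map_word (@Some X) u = map_word Some p ++ map_word Some (drop (size p) u).
    by rewrite -map_word_cat -{1}(cat_take_drop (size p) u) -(prefix_take_eq pu).
  by rewrite E -!catA.
by rewrite embed_class // Gp_eltM.
Qed.

(** In the group [t^-1 u t] equals [v]; a prefix of the relator that ends inside [v^-1] removes a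
    suffix from this [v] and leaves a prefix of [v]. *)
Lemma prefix_monoid_v (p : word X) : prefix p v -> prefix_monoid (embed (free_class p) : Gp w).
Proof.
move=> pv; apply: gen_base.
exists ([:: tletter X true] ++ map_word Some u ++ [:: tletter X false] ++ map_word Some (word_inv
  (drop (size p) v))).
  rewrite relatorE; apply/prefixP; exists (map_word Some (word_inv p)).
  have E : word_inv (map_word (@Some X) v) =
      map_word Some (word_inv (drop (size p) v)) ++ map_word Some (word_inv p).
    rewrite -map_word_inv -map_word_cat -word_invM; congr (map_word Some (word_inv _)).
    by rewrite -{1}(cat_take_drop (size p) v) -(prefix_take_eq pv).
  by rewrite E -!catA.
rewrite !Gp_eltM -!embed_class // free_classV embedV // 2!mulgA.
rewrite -[_ * embed _ * _](_ : embed (assoc true) = _); last first.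
  rewrite -[Gp_elt _ [:: tletter X true]]/(stable true) -[Gp_elt _ [:: tletter X false]]/(stable
    false).
  rewrite -[embed (free_class u)]/(embed (assoc (~~ true))) -assoc_stable // -mulgA.
  by rewrite (stableV u v true) mulg1.
have E : free_class v = free_class p * free_class (drop (size p) v).
  by rewrite -free_classM -{1}(cat_take_drop (size p) v) -(prefix_take_eq pv).
by rewrite -embedV // -embedM // -[assoc true]/(free_class v) E mulgK.
Qed.

Lemma prefix_monoid_Qv (q : H) : Qv q -> prefix_monoid (embed q : Gp w).
Proof.
elim=> {q} [q [p pv ->]||q r _ IHq _ IHr]; first exact: prefix_monoid_v.
  by rewrite embed1 //; apply: gen_one.
by rewrite embedM //; apply: gen_mul.
Qed.

Lemma stack_mem_sound s h : stack_mem s h -> prefix_monoid (gstack u v s * embed h).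
Proof.
elim: s h => [|[e r] s IH] h /=; first by rewrite mul1g; apply: prefix_monoid_Qv.
case=> [-> [m [n [/IH I [p [q pu [Qq E]]]]]]].
have -> : gstack u v s * embed r * stable true * embed h =
    (gstack u v s * embed (r * zexp (assoc true) m n)) *
    ((stable true * embed (free_class p)) * embed q).
  rewrite (embedM u v r) -!mulgA -[embed (free_class p) * _]embedM -E (embedM u v _ h).
  congr (_ * (_ * _)); rewrite [in RHS]mulgA zexp_stable /= -!mulgA; congr (_ * _).
  by rewrite mulgA -embedM zexpD zexpE addnC leqnn subnn embed1 mul1g.
by apply: gen_mul => //; apply: gen_mul; [apply: prefix_monoid_t | apply: prefix_monoid_Qv].
Qed.

Lemma stack_mem_prefix (q : word (option X)) st : prefix q w -> valid u v st.2 ->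
  stack_mem st.2 st.1 -> stack_mem (act u v st q).2 (act u v st q).1.
Proof.
case: st => h s pw vs I.
(* All stable letters on the stack are [t^-1], so multiplying by a further [t^-1] never pinches. *)
have Et : stepT u v true (h, s) =
    (slide u v true ((crep u v true h)^-1 * h), (true, crep u v true h) :: s).
  by rewrite /stepT /=; case: s I {vs} => //= p s [-> _].
have St p : prefix p u -> let st := act u v (h, s) ([:: tletter X true] ++ map_word Some p) in
  stack_mem st.2 st.1.
  move=> pu; rewrite act_cat act_embed [act _ _ _ _]Et /=; split=> //.
  (* The exponent is that of the power of [v] which the normal form has split off from [h]: moved
     back across [t^-1], it leaves only the prefix [p] on the right. *)
  have [m [n E]] := crep_cyc u_neq_nil v_neq_nil u_reduced v_reduced true h.
  exists m, n; rewrite -E mulVKg; split=> //; rewrite E /slide phi_zexp;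
    last exact: assoc_unbounded.
  rewrite mulgA zexpD zexpE addnC leqnn subnn mul1g.
  by exists p, 1 => //; split; [apply: gen_one | rewrite mulg1].
have Sv q' : prefix q' (word_inv (map_word Some v)) ->
    let st := act u v (h, s) ([:: tletter X true] ++ map_word Some u ++ [:: tletter X false] ++ q')
      in stack_mem st.2 st.1.
  move=> pv.
  have -> : q' = map_word Some (word_inv (drop (size v - size q') v)).
    rewrite map_word_inv {1}(prefix_take_eq pv) /word_inv take_rev.
    by rewrite /map_word !map_drop !size_map.
  rewrite !catA act_cat act_embed -!catA.
  have -> : act u v (h, s) ([:: tletter X true] ++ map_word Some u ++ [:: tletter X false]) =
    (h * assoc true, s).
    rewrite !act_cat act_embed [act _ _ _ [:: tletter X true]]/(stepT u v true (h, s)).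
    rewrite -[free_class u]/(assoc (~~ true)) -stepT_assoc //.
    have E := @stepTK _ _ _ u_neq_nil v_neq_nil u_reduced v_reduced true (h * assoc true, s) vs.
    by rewrite -{2}E.
  rewrite /= -mulgA; apply: stack_mem_Qv => //; apply: gen_base.
  exists (take (size v - size q') v); first exact: prefix_take.
  rewrite -[assoc true]/(free_class v) free_classV.
  by rewrite -[in free_class v](cat_take_drop (size v - size q') v) free_classM mulgK.
move: pw; rewrite relatorE => /prefix_cat_cases[|[q1 + ->]].
  rewrite prefixs1 => /orP[] /eqP -> //; exact: (St [::] (prefix0s _)).
move=> /prefix_cat_cases[|[q2 + ->]].
  move=> pq; have -> : q1 = map_word Some (take (size q1) u).
    by rewrite /map_word map_take -(prefix_take_eq pq).
  by apply: St; apply: prefix_take.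
move=> /prefix_cat_cases[|[q3 + ->]]; last exact: Sv.
rewrite prefixs1 => /orP[] /eqP ->; first by rewrite cats0; apply: St; apply: prefix_refl.
exact: (Sv [::] (prefix0s _)).
Qed.

Lemma Gp_elt_surj (g : Gp w) : exists x, Gp_elt w x = g.
Proof.
exists (fword (mquot_repr g)); rewrite /Gp_elt fwordK; exact: mquot_reprK.
Qed.

Theorem prefix_monoid_stack_mem x : prefix_monoid (Gp_elt w x) <->
  stack_mem (nf u v x).2 (nf u v x).1.
Proof.
split=> [P|I]; last by rewrite -(gstate_nf u_neq_nil v_neq_nil) //; apply: stack_mem_sound.
have Ag x1 x2 := @act_Gp _ _ _ u_neq_nil v_neq_nil u_reduced v_reduced x1 x2.
have : stack_mem (init X).2 (init X).1 by apply: gen_one.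
have : valid u v (init X).2 by [].
(* The starting state is generalized because, in a product, the second factor acts on the state that
   the first one leaves. *)
rewrite /nf; move: (init X) => st.
move Eg: (Gp_elt w x) P => g P; elim: P x Eg st => {g} [g [q pq ->]||g h _ IHg _ IHh] x Ex st vs I.
- by rewrite (Ag _ _ Ex) //; apply: stack_mem_prefix.
- by rewrite (Ag _ [::] Ex).
have [y Ey] := Gp_elt_surj g; have [z Ez] := Gp_elt_surj h.
rewrite (Ag _ (y ++ z)) ?Gp_eltM ?Ey ?Ez // act_cat.
by apply: IHh => //; [apply: act_valid | apply: IHg].
Qed.

End PrefixMonoid.

(** * Rational subsets of free groups *)

Section Split.
Variable Z : choiceType.
Implicit Types (x y h : word Z) (a b : Z * bool).

Lemma reduced_rcons h a b :
  reduced (rcons h a) -> b != letter_inv a -> reduced (rcons (rcons h a) b).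
Proof.
move=> r ne; rewrite -!cats1 -catA; apply: reduced_glue => //; first by rewrite cats1.
by rewrite reduced_cons ne.
Qed.

Lemma free_class_rcons x a : free_class (rcons x a) = free_class x * free_class [:: a].
Proof. by rewrite -cats1 free_classM. Qed.

Lemma free_class_letterV a : free_class [:: letter_inv a] = (free_class [:: a])^-1.
Proof. by rewrite -free_classV. Qed.

(** If the last letter [b] of [x] is not [a], the word before it reduces to [h a b^-1]. The
    induction hypothesis finds there the letter [b^-1] that cancels [b], and, applied to the part
    before that letter, finds [a]. *)
Lemma free_class_split x h a : reduced (rcons h a) -> free_class x = free_class (rcons h a) ->
  exists x' x'', [/\ x = x' ++ a :: x'', free_class x' = free_class h & free_class x'' = 1].
Proof.
elim/ltn_ind: {x}(size x) {-2}x (erefl (size x)) h a => n IH x Ex h a rh.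
case/lastP: x Ex => [|y b] Ex E.
  by have := congr1 (@fword Z) E; rewrite !fwordE (red_id rh); case: (h).
have sy : size y < n by rewrite -Ex size_rcons.
have [Eb|ne] := eqVneq b a.
  exists y, [::]; split; rewrite ?cats1 ?Eb //; move: E; rewrite Eb !free_class_rcons.
  exact: mulIg.
have Ey : free_class y = free_class (rcons (rcons h a) (letter_inv b)).
  by rewrite free_class_rcons -E free_class_rcons free_class_letterV mulgK.
have [|y1 [y2 [Ey12 Ey1 Ey2]]] := IH _ sy y erefl _ _ _ Ey.
  by apply: reduced_rcons => //; rewrite (inj_eq (can_inj (@letter_invK Z))).
have sy1 : size y1 < n by apply: leq_trans sy; rewrite Ey12 size_cat ltnS leq_addr.
have [x' [y3 [Ey13 Ex' Ey3]]] := IH _ sy1 y1 erefl _ _ rh Ey1.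
exists x', (y3 ++ letter_inv b :: rcons y2 b); split=> //.
  by rewrite Ey12 Ey13 -catA rcons_cat /= rcons_cat.
rewrite free_classM Ey3 mul1g -cat1s free_classM free_class_rcons Ey2 mul1g.
by rewrite free_class_letterV mulVg.
Qed.

End Split.

Section Automaton.
Variables (Z : choiceType) (C : finType).
Variables (silent : rel C) (edge : C -> Z * bool -> C -> bool).
Implicit Types (x y h : word Z) (a b : Z * bool) (c : C).

Inductive reach : C -> word Z -> C -> Prop :=
| reach_refl c : reach c [::] c
| reach_silent c c1 x c2 of silent c c1 & reach c1 x c2 : reach c x c2
| reach_move c a c1 x c2 of edge c a c1 & reach c1 x c2 : reach c (a :: x) c2.

Lemma reach_cat c x c1 y c2 : reach c x c1 -> reach c1 y c2 -> reach c (x ++ y) c2.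
Proof.
elim=> {c x c1} //= [c c1 x c3 s _ IH|c a c1 x c3 m _ IH] r2.
  exact: reach_silent s (IH r2).
exact: reach_move m (IH r2).
Qed.

Lemma reach_split c z c2 : reach c z c2 -> forall x y, z = x ++ y ->
  exists2 c1, reach c x c1 & reach c1 y c2.
Proof.
elim=> {c z c2} [c|c c1 z c2 s _ IH|c a c1 z c2 m r IH] x y E.
- by case: x E => //= <-; exists c; apply: reach_refl.
- by have [c3 r1 r2] := IH _ _ E; exists c3 => //; apply: reach_silent r1.
case: x E => [E|b x [<- E]]; last first.
  by have [c3 r1 r2] := IH _ _ E; exists c3 => //; apply: reach_move r1.
by exists c; [apply: reach_refl | rewrite -[y]E; apply: reach_move r].
Qed.

Lemma reach_cons c a x c2 : reach c (a :: x) c2 ->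
  exists c1 c3, [/\ reach c [::] c1, edge c1 a c3 & reach c3 x c2].
Proof.
move Ez: (a :: x) => z r; elim: r Ez => {c z c2} // [c c1 z c2 s _ IH|c b c1 z c2 m r IH].
  by move=> /IH [c3 [c4 [r1 m r2]]]; exists c3, c4; split=> //; apply: reach_silent r1.
by case=> -> ->; exists c, c1; split=> //; apply: reach_refl.
Qed.

Definition reachable c0 (g : free_group Z) : {set C} :=
  [set c | `[< exists2 x, reach c0 x c & free_class x = g >]].

(** The subset construction, where the closure under silent moves is enlarged to all words that
    freely reduce to the empty one. *)
Definition dstep (S : {set C}) a : {set C} :=
  [set c | `[< exists c1 c2, [/\ c1 \in S, edge c1 a c2 & c \in reachable c2 1] >]].

(* Benois: in a word that freely reduces to [h a], the letter [a] survives and is surrounded by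
   a word that reduces to [h] and a word that reduces to the empty one. *)
Lemma reachable_rcons c0 h a : reduced (rcons h a) ->
  reachable c0 (free_class (rcons h a)) = dstep (reachable c0 (free_class h)) a.
Proof.
move=> rh; apply/setP => c; rewrite !inE; apply/asboolP/asboolP.
  case=> x r E; have [x' [x'' [Ex E' E'']]] := free_class_split rh E.
  have [c1 r1 /reach_cons [c2 [c3 [r2 m r3]]]] := reach_split r Ex.
  exists c2, c3; split=> //; rewrite inE; apply/asboolP; last by exists x''.
  by exists (x' ++ [::]); [apply: reach_cat r1 r2 | rewrite cats0].
case=> c1 [c2 []]; rewrite !inE => /asboolP[x r1 E] m /asboolP[y r2 E'].
exists (x ++ a :: y); first by apply: reach_cat r1 _; apply: reach_move r2.
by rewrite -[a :: y]cat1s !free_classM E E' mulg1 free_class_rcons.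
Qed.

Lemma reachable_foldl c0 g : reachable c0 g = foldl dstep (reachable c0 1) (fword g).
Proof.
rewrite -{1}[g]fwordK; have := fword_reduced g; elim/last_ind: (fword g) => //= h a IH rh.
rewrite -cats1 foldl_cat /= -IH; first by rewrite cats1 reachable_rcons.
by move: rh; rewrite -cats1 => /reduced_catl.
Qed.

End Automaton.

(** * Pumping powers of a reduced word in a finite automaton *)

Section Pumping.
Variables (Z : choiceType) (D : finType) (delta : D -> Z * bool -> D) (d0 : D) (acc : pred D).
Implicit Types (g : free_group Z) (v : word Z).

Definition accepts g := acc (foldl delta d0 (fword g)).

(* Once [v^n] absorbs [g], the run on [g v^(n+k)] iterates a fixed map of the finite set [D]. *)
Lemma accepts_pow v g n : reduced v -> v != [::] -> len g < n ->
  exists (F : D -> D) (d1 : D) (P : pred D), forall k,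
    accepts (g * free_class v ^+ (n + k)) = P (iter k F d1).
Proof.
move=> rv vn gn; have [s [z [_ /(_ g n gn) [t Et]]]] := fword_pow_tail rv vn.
exists (fun d => foldl delta d s), (foldl delta d0 t), (fun d => acc (foldl delta d z)) => k.
rewrite /accepts Et !foldl_cat; congr (acc (foldl _ _ _)).
by elim: k (foldl delta d0 t) => // k IH d; rewrite expwS foldl_cat IH iterSr.
Qed.

Lemma iter_pigeonhole (F : D -> D) d k : exists2 i, i < #|D| & iter k F d = iter i F d.
Proof.
have c := fconnect_iter F k d; exists (findex F d (iter k F d)); last by rewrite iter_findex.
exact: leq_trans (findex_max c) (max_card _).
Qed.

(** The first [len g + 1] powers absorb [g]; the [#|D|] further ones run through every state of the
    ensuing orbit. *)
Definition bound g := (len g).+1 + #|D|.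

(** By monotonicity the exponent [len g + 1 + k] is accepted too. It leads to the same state as
    [len g + 1 + i] for some [i < #|D|], and monotonicity carries acceptance from there up to the
    bound. *)
Lemma accepts_large v g k : reduced v -> v != [::] ->
  (forall h, accepts h -> accepts (h * free_class v)) ->
  accepts (g * free_class v ^+ k) -> accepts (g * free_class v ^+ bound g).
Proof.
move=> rv vn mono a.
have monoX h n : accepts h -> accepts (h * free_class v ^+ n).
  by elim: n => [|n IH] ah; rewrite ?mulg1 // expgSr mulgA mono ?IH.
have le i j : i <= j -> accepts (g * free_class v ^+ i) -> accepts (g * free_class v ^+ j).
  by move=> /subnKC <- ai; rewrite expgnDr mulgA monoX.
have [F [d1 [P E]]] := accepts_pow rv vn (ltnSn (len g)).
have [i lti Ei] := iter_pigeonhole F d1 k.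
apply: (le ((len g).+1 + i)); first by rewrite leq_add2l ltnW.
by rewrite E -Ei -E; apply: le a; rewrite leq_addl.
Qed.

(** The same pumping with [v^-1]: the exponent [-(len g + 1 + k)] leads to the same state as some
    [-(len g + 1 + i)] with [i < #|D|], which lies above [- bound g] and is accepted by
    monotonicity. *)
Lemma accepts_small v g k : reduced v -> v != [::] ->
  (forall h, accepts h -> accepts (h * free_class v)) ->
  accepts (g * free_class v ^- bound g) -> accepts (g * free_class v ^- k).
Proof.
move=> rv vn mono a.
have le i j : i <= j -> accepts (g * free_class v ^- j) -> accepts (g * free_class v ^- i).
  move=> /subnKC <-; elim: (j - i) => [|n IH]; rewrite ?addn0 // addnS => an.
  apply: IH; have := mono _ an; by rewrite expgS invgM mulgA mulgVK.
have rv' : reduced (word_inv v) by rewrite reduced_inv.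
have vn' : word_inv v != [::] by rewrite -size_eq0 size_word_inv size_eq0.
have [F [d1 [P E]]] := accepts_pow rv' vn' (ltnSn (len g)).
have {}E i : accepts (g * free_class v ^- ((len g).+1 + i)) = P (iter i F d1).
  by rewrite -E free_classV expVgn.
have [i lti Ei] := iter_pigeonhole F d1 k.
apply: (le k ((len g).+1 + k)); first by rewrite leq_addl.
by rewrite E Ei -E; apply: le a; rewrite leq_add2l ltnW.
Qed.

End Pumping.

(** * A finite automaton for the completion sets *)

Section Rational.
Variables (X : finType) (u v : word X).
Notation H := (free_group X).
Notation Qv := (Qv v).
Notation Nu := (Nu u v).
Notation uu := (free_class u).

(* The phases of a path: reading copies of [u^-1], then copies of [u] and a prefix of [u], then
   prefixes of [v]. *)
Definition phase := option bool.

(** Up to left translation, these are all the nonempty sets of elements that can complete a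
    stack. *)
Definition rat (j : phase) (h : H) : Prop :=
  match j with
  | None => exists m n : nat, Nu (zexp uu m n * h)
  | Some false => exists n : nat, Nu (uu ^- n * h)
  | Some true => Qv h
  end.

Lemma Nu_Qv h g : Nu h -> Qv g -> Nu (h * g).
Proof.
case=> p [q pu [Qq ->]] Qg; exists p, (q * g) => //; split; first exact: gen_mul.
by rewrite mulgA.
Qed.

Lemma rat_Qv j h g : rat j h -> Qv g -> rat j (h * g).
Proof.
case: j => [[]|] /=; first exact: gen_mul.
  by case=> n N Q; exists n; rewrite mulgA; apply: Nu_Qv.
by case=> m [n N] Q; exists m, n; rewrite mulgA; apply: Nu_Qv.
Qed.

Definition pword (j : phase) : word X :=
  match j with None => word_inv u | Some false => u | Some true => v end.

Definition cfg : finType := (phase * 'I_(size u + size v).+1)%type.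

Definition edge (c : cfg) (a : X * bool) (c' : cfg) : bool :=
  [&& c'.1 == c.1, val c'.2 == (val c.2).+1, c.2 < size (pword c.1) & nth a (pword c.1) c.2 == a].

Definition silent (c c' : cfg) : bool := (val c'.2 == 0) &&
  match c.1, c'.1 with
  | None, None => val c.2 == size u
  | None, Some false => val c.2 == 0
  | Some false, Some false => val c.2 == size u
  | Some _, Some true => true
  | _, _ => false
  end.

Notation reach := (reach silent edge).

Definition start (j : phase) : cfg := (j, ord0).
Definition final (c : cfg) : bool := c.1 != None.

Definition upow (j : phase) (h : H) : Prop :=
  match j with
  | None => cyc uu h
  | Some false => exists n, h = uu ^+ n
  | Some true => False
  end.

(** Here [j] is the initial phase and [g] the value read so far; [h] is the value before the
    current, possibly incomplete, copy was begun. *)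
Definition invariant (j : phase) (c : cfg) (g : H) : Prop :=
  let h := g / free_class (take c.2 (pword c.1)) in
  match c.1 with
  | None => j = None /\ exists n, h = uu ^- n
  | Some false => upow j h
  | Some true => rat j h
  end.

Lemma upow_rat j h p : upow j h -> prefix p u -> rat j (h * free_class p).
Proof.
have N p' : prefix p' u -> Nu (free_class p').
  by move=> pu; exists p', 1 => //; rewrite mulg1; split=> //; apply: gen_one.
case: j => [[]|] //= [m].
  by move=> -> /N; exists m; rewrite mulKg.
by case=> n -> /N; exists n, m; rewrite mulgA zexpD zexpE addnC leqnn subnn mul1g.
Qed.

Lemma invariant_edge j c a c' g : edge c a c' -> invariant j c g ->
  invariant j c' (g * free_class [:: a]).
Proof.
case: c c' => [k i] [k' i'] /and4P[/= /eqP -> /eqP Ei lt /eqP Ea]; rewrite /invariant /=.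
suff -> : g * free_class [:: a] / free_class (take i' (pword k)) =
  g / free_class (take i (pword k)) by [].
by rewrite Ei (take_nth a) // Ea free_class_rcons invgM mulgA mulgK.
Qed.

Lemma invariant_rat j c g : final c -> invariant j c g -> rat j g.
Proof.
case: c => [[[]|] i] // _; rewrite /invariant /=.
  move/rat_Qv => /(_ (free_class (take i v))); rewrite mulgVK; apply.
  by apply: gen_base; exists (take i v); rewrite ?prefix_take.
by move/upow_rat => /(_ (take i u) (prefix_take _ _)); rewrite mulgVK.
Qed.

Lemma invariant_silent j c c' g : silent c c' -> invariant j c g -> invariant j c' g.
Proof.
case: c c' => [k i] [k' i'] /andP[/= /eqP i0]; rewrite {2}/invariant /= i0 take0 invg1 mulg1.
case: k k' => [[]|] [[]|] //=.
- by move=> _; apply: invariant_rat.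
- by move=> _; apply: invariant_rat.
- move/eqP=> iu; rewrite /invariant /= iu take_size.
  case: j => [[]|] //= [n].
    by move/(congr1 (mul^~ uu)); rewrite mulgVK => ->; exists n.+1; rewrite expgSr.
  case=> m /(congr1 (mul^~ uu)); rewrite mulgVK => ->.
  by rewrite zexpSr; do 2 eexists.
- move/eqP=> i1; rewrite /invariant /= i1 take0 invg1 mulg1 => -[-> [n ->]].
  by exists 0, n; rewrite zexp0n.
move/eqP=> iu; rewrite /invariant /= iu -(size_word_inv u) take_size.
rewrite free_classV invgK => -[-> [n]] /(congr1 (mul^~ uu^-1)); rewrite mulgK => ->; split=> //.
by exists n.+1; rewrite expgS invgM.
Qed.

Lemma invariant_start j : invariant j (start j) 1.
Proof.
rewrite /invariant /= take0 invg1 mulg1; case: j => [[]|] /=; first exact: gen_one.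
  by exists 0.
by split=> //; exists 0; rewrite invg1.
Qed.

Lemma reach_invariant j c x c' g : reach c x c' -> invariant j c g ->
  invariant j c' (g * free_class x).
Proof.
move=> r; elim: r g => {c x c'} [c|c c1 x c2 s _ IH|c a c1 x c2 e _ IH] g I.
- by rewrite mulg1.
- by apply: IH; apply: invariant_silent I.
by rewrite -cat1s free_classM mulgA; apply: IH; apply: invariant_edge I.
Qed.

Lemma pos_lt j i : i <= size (pword j) -> i < (size u + size v).+1.
Proof.
move=> le; rewrite ltnS (leq_trans le) //.
by case: j {le} => [[]|] /=; rewrite ?size_word_inv ?leq_addl ?leq_addr.
Qed.

Lemma reach_pword j i : i <= size (pword j) -> reach (start j) (take i (pword j)) (j, inord i).
Proof.
elim: i => [|i IH] le; first by rewrite take0 (_ : inord 0 = ord0);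
  [exact: reach_refl | apply: val_inj; rewrite /= inordK].
have [a _] : exists a, a \in pword j by case: (pword j) le => // a s _; exists a; rewrite mem_head.
rewrite (take_nth a) // -cats1; apply: reach_cat (IH (ltnW le)) _.
apply: reach_move; last exact: reach_refl.
rewrite /edge /= (inordK (pos_lt le)) (inordK (pos_lt (ltnW le))).
by rewrite !eqxx le /= (set_nth_default a).
Qed.

Lemma reach_jump j i k : i <= size (pword j) -> silent (j, inord i) (start k) ->
  reach (start j) (take i (pword j)) (start k).
Proof.
move=> le s; rewrite -[take _ _]cats0; apply: reach_cat (reach_pword le) _.
by apply: reach_silent s _; constructor.
Qed.

Lemma reach_Qv q : Qv q -> exists2 x, reach (start (Some true)) x (start (Some true)) & free_class
  x = q.
Proof.
elim=> {q} [q [p pv ->]||q r _ [x rx <-] _ [y ry <-]].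
- exists p => //; rewrite (prefix_take_eq pv); apply: (@reach_jump (Some true)) => //.
  exact: size_prefix.
- by exists [::] => //; exact: reach_refl.
by exists (x ++ y); [apply: reach_cat rx ry | rewrite free_classM].
Qed.

Lemma reach_Nu h : Nu h -> exists2 x, reach (start (Some false)) x (start (Some true)) & free_class
  x = h.
Proof.
case=> p [q pu [/reach_Qv [x rx <-] ->]]; exists (p ++ x); rewrite ?free_classM //.
apply: reach_cat rx; rewrite (prefix_take_eq pu); apply: (@reach_jump (Some false)) => //.
exact: size_prefix.
Qed.

Lemma reach_upow n x c : reach (start (Some false)) x c ->
  reach (start (Some false)) (u ^+ n ++ x) c.
Proof.
move=> r; elim: n => // n IH; rewrite expwS -catA; apply: reach_cat IH.
rewrite -{1}(take_size u); apply: (@reach_jump (Some false)) => //.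
by rewrite /silent /= inordK ?eqxx // ltnS leq_addr.
Qed.

Lemma reach_uinv n x c : reach (start None) x c ->
  reach (start None) (word_inv u ^+ n ++ x) c.
Proof.
move=> r; elim: n => // n IH; rewrite expwS -catA; apply: reach_cat IH.
rewrite -{1}(take_size (word_inv u)); apply: (@reach_jump None) => //.
by rewrite /silent /= inordK ?size_word_inv ?eqxx // ltnS leq_addr.
Qed.

Lemma reach_rat j h : rat j h -> exists2 x, reach (start j) x (start (Some true)) & free_class x =
  h.
Proof.
case: j => [[]|] /=; first exact: reach_Qv.
  case=> n /reach_Nu [x r E]; exists (u ^+ n ++ x); first exact: reach_upow.
  by rewrite free_classM free_classX E mulVKg.
case=> m [n /reach_Nu [x r E]]; exists (word_inv u ^+ m ++ (u ^+ n ++ x)).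
  apply: reach_uinv; apply: reach_silent (reach_upow n r).
  by [].
rewrite !free_classM !free_classX E free_classV expVgn mulgA.
by rewrite -zexp_commuteV mulgA zexpD zexpE addnC leqnn subnn mul1g.
Qed.

Definition dfa : finType := {set cfg}.
Definition delta (d : dfa) a : dfa := dstep silent edge d a.
Definition dinit (j : phase) : dfa := reachable silent edge (start j) 1.
Definition dacc (d : dfa) : bool := [exists c in d, final c].

Lemma ratP j h : rat j h <-> accepts delta (dinit j) dacc h.
Proof.
rewrite /accepts -reachable_foldl; split=> [/reach_rat [x r E]|/existsP[c /andP[]]].
  by apply/existsP; exists (start (Some true)); rewrite inE; apply/andP; split=> //; apply/asboolP;
    exists x.
rewrite inE => /asboolP[x r <-] f; apply: (invariant_rat f).
by rewrite -[free_class x]mul1g; apply: reach_invariant r (invariant_start j).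
Qed.

End Rational.

(** * Deciding membership in the prefix monoid *)

Section Summary.
Variables (X : finType) (u v : word X).
Hypotheses (u_neq_nil : u != [::]) (v_neq_nil : v != [::]).
Hypotheses (u_reduced : reduced u) (v_reduced : reduced v).
Notation H := (free_group X).
Notation uu := (free_class u).
Notation vv := (free_class v).

Definition ratb (j : phase) (h : H) : bool := accepts (@delta X u v) (dinit u v j) (@dacc X u v) h.

(* [(Some j, a)] stands for the set [a * rat j], and [(None, a)] for the empty set. *)
Definition summary_set (q : option phase * H) (h : H) : Prop :=
  if q.1 is Some j then rat u v j (q.2^-1 * h) else False.

Definition window (g : H) : nat := bound (dfa u v) g.

(** The cases are: no admissible exponent, all of them, and a ray [[K, oo)]. The search counts from
    [- window g], so [K] is its result minus [window g], and the translation is by [u^K]. *)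
Definition summary_next (j : phase) (g : H) : option phase * H :=
  if ~~ ratb j (g * vv ^+ window g) then (None, 1)
  else if ratb j (g * vv ^- window g) then (Some None, 1)
  else (Some (Some false),
        uu ^- window g *
        uu ^+ search (fun n => ratb j (g * vv ^- window g * vv ^+ n)) (window g + window g)).

Definition summary_step (p : bool * H) (q : option phase * H) : option phase * H :=
  if p.1 then if q.1 is Some j then summary_next j (q.2^-1 * p.2) else (None, 1) else (None, 1).

Definition summary (s : seq (bool * H)) : option phase * H :=
  foldr summary_step (Some (Some true), 1) s.

Lemma ratbP j h : rat u v j h <-> ratb j h. Proof. exact: ratP. Qed.

Lemma rat_vv j h : rat u v j h -> rat u v j (h * vv).
Proof. by move=> r; apply: rat_Qv r _; apply: gen_base; exists v => //; apply: prefix_refl. Qed.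

Lemma rat_vvX j h n : rat u v j h -> rat u v j (h * vv ^+ n).
Proof. by elim: n => [|n IH] r; rewrite ?mulg1 // expgSr mulgA; apply: rat_vv; apply: IH. Qed.

Lemma ratb_vv j h : ratb j h -> ratb j (h * vv).
Proof. by move=> /ratbP r; apply/ratbP/rat_vv. Qed.

(* The exponents [k] with [g v^k] in [rat j] form an up-set of the integers; by pumping it is empty
   or all of them unless its least element lies in the window. *)
Lemma summary_nextP j g h : summary_set (summary_next j g) h <->
  exists m n, rat u v j (g * zexp vv m n) /\ Nu u v (zexp uu n m * h).
Proof.
rewrite /summary_next /summary_set; set B := window g.
case: ifP => [/negP no|/negbFE yes].
  split=> // -[m [n [r _]]]; apply: no; apply: (@accepts_large _ _ _ _ _ v g m) => //.
    exact: ratb_vv.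
  apply/ratbP; rewrite -(_ : zexp vv m n * vv ^+ n = vv ^+ m); last exact: mulgVK.
  by rewrite mulgA; apply: rat_vvX.
case: ifP => [all|/negbT/negP some].
  have {}all k : rat u v j (g * vv ^- k).
    by apply/ratbP; apply: accepts_small all => //; apply: ratb_vv.
  rewrite /= invg1 mul1g; split=> [[m [n N]]|[m [n [_ N]]]]; last by exists n, m.
  by exists n, m; split=> //; rewrite /zexp zexp_commuteV mulgA; apply: rat_vvX.
pose P n := ratb j (g * vv ^- B * vv ^+ n).
rewrite -/P; set n0 := search P (B + B); rewrite /=.
have PE n : P n = ratb j (g * zexp vv n B) by rewrite /P -mulgA -zexp_commuteV.
have [n0le [n0min n0in]] := searchP P (B + B); rewrite -/n0 in n0le n0min n0in.
(* A failed search returns [B + B], which stands for the exponent [B]; that one is admissible by the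
   first test. *)
have Pn0 : P n0.
  move: n0le; rewrite leq_eqVlt => /predU1P[->|]; last exact: n0in.
  by rewrite PE (_ : zexp vv _ _ = vv ^+ B) // -zexpn0; apply: zexp_congr; rewrite addn0.
have key m n : rat u v j (g * zexp vv m n) <-> (n0 + n <= m + B)%N.
  split=> [r|le]; last first.
    rewrite -(@zexp_congr _ vv (n0 + (m + B - (n0 + n))) B); last lia.
    rewrite -(addn0 B) -zexpD zexpn0 mulgA; apply: rat_vvX; apply/ratbP.
    by rewrite -PE.
  rewrite leqNgt; apply/negP => lt.
  (* An admissible exponent below [n0 - B] makes the exponent [n0 - 1 - B] admissible, against
     minimality. For [n0 = 0] it makes [-B] admissible, against the second test. *)
  case E0 : n0 lt => [|n1] lt.
    apply: some; apply/ratbP; rewrite -zexp0n.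
    rewrite -(@zexp_congr _ vv (m + (n - (m + B))) n); last lia.
    by rewrite -(addn0 n) -zexpD zexpn0 mulgA; apply: rat_vvX.
  have /n0min : n1 < n0 by rewrite E0.
  move/negP; apply; rewrite PE; apply/ratbP.
  rewrite -(@zexp_congr _ vv (m + (n1 + n - (m + B))) n); last lia.
  by rewrite -(addn0 n) -zexpD zexpn0 mulgA; apply: rat_vvX.
rewrite -zexp_commuteV -/(zexp _ _ _); split=> [[k N]|[m [n [/key le N]]]].
  exists (n0 + k)%N, B; split; first by apply/key; rewrite addnAC leq_addr.
  by move: N; rewrite zexpV mulgA -zexp0n zexpD add0n addnC.
exists (m + B - (n0 + n))%N; rewrite zexpV mulgA -zexp0n zexpD add0n.
rewrite (@zexp_congr _ _ _ _ n m) //; lia.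
Qed.

Lemma summaryP s h : stack_mem u v s h <-> summary_set (summary s) h.
Proof.
elim: s h => [|[e r] s IH] h; first by rewrite /summary_set /= invg1 mul1g.
rewrite -[summary _]/(summary_step (e, r) (summary s)) /summary_step /=.
case: e => /=; last by split=> // -[].
case E : (summary s) IH => [[j|] a] IH /=; last first.
  by split=> // -[_ [m [n [/IH]]]].
split=> [[_ [m [n [/IH I N]]]]|/summary_nextP [m [n [I N]]]].
  by apply/summary_nextP; exists m, n; rewrite -mulgA.
by split=> //; exists m, n; split=> //; apply/IH; rewrite /summary_set /= mulgA.
Qed.

End Summary.

(** * Computability of the free group operations *)

Section ComputableGroup.
Variables (X : finType).
Notation H := (free_group X).
Notation eH := (@enc X).
Notation eW := (eseq (@efin (X * bool)%type)).

Lemma comp_fword G (eG : G -> nat) f : computable eG eW (fun c => fword (f c)) <->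
  computable eG eH f.
Proof. by []. Qed.

Lemma comp_push G (eG : G -> nat) a s : computable eG (@efin (X * bool)%type) a ->
  computable eG eW s ->
  computable eG eW (fun c => push (a c) (s c)).
Proof.
move=> Ha Hs; apply: (comp_fin (h := fun a c => push a (s c)) _ Ha) => t.
apply: (comp_match Hs (comp_const _ _ _) _).
apply: (comp_fin (h := fun b (p : G * ((X * bool) * seq (X * bool))) =>
  if b == letter_inv t then p.2.2 else t :: s p.1) (f := fun p => p.2.1)).
  move=> b; case: eqP => _; first exact: comp_snd (comp_snd (comp_id _)).
  exact: comp_cons (comp_const _ _ _) (comp_comp Hs (comp_fst (comp_id _))).
exact: comp_fst (comp_snd (comp_id _)).
Qed.

Lemma comp_mul G (eG : G -> nat) f g : computable eG eH f -> computable eG eH g ->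
  computable eG eH (fun c => f c * g c).
Proof.
move=> /comp_fword Hf /comp_fword Hg; apply/comp_fword.
apply: (@eq_computable _ _ _ _ (fun c => foldl (fun s a => push a s) (fword (g c)) (rev (fword (f
  c))))).
  by move=> c; rewrite foldl_rev fwordM.
apply: (comp_foldl (f := fun _ s a => push a s) (comp_rev Hf) Hg).
apply: comp_push; first exact: comp_snd (comp_snd (comp_id _)).
exact: comp_fst (comp_snd (comp_id _)).
Qed.

Lemma fwordV (h : H) : fword h^-1 = word_inv (fword h).
Proof. by rewrite -{1}(fwordK h) -free_classV fwordE red_id // reduced_inv fword_reduced. Qed.

Lemma comp_word_inv G (eG : G -> nat) (Z : finType) (x : G -> word Z) :
  computable eG (eseq (@efin (Z * bool)%type)) x ->
  computable eG (eseq (@efin (Z * bool)%type)) (fun c => word_inv (x c)).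
Proof.
set eL := eseq _ => Hx.
have H : computable eG eL (fun c => foldl (fun s a => letter_inv a :: s) [::] (x c)).
  apply: (comp_foldl (f := fun _ s a => letter_inv a :: s) Hx (comp_const _ _ _)).
  apply: comp_cons; last exact: comp_fst (comp_snd (comp_id _)).
  apply: (comp_fin (h := fun a _ => letter_inv a)) (comp_snd (comp_snd (comp_id _))) => a.
  exact: comp_const.
apply: eq_computable H => c; rewrite /word_inv /rev.
by elim: (x c) [::] => //= a s IH r; rewrite IH.
Qed.

Lemma comp_inv G (eG : G -> nat) f : computable eG eH f -> computable eG eH (fun c => (f c)^-1).
Proof.
move=> /comp_fword Hf; apply/comp_fword.
by apply: eq_computable (comp_word_inv Hf) => c; rewrite fwordV.
Qed.

Lemma comp_eqH G (eG : G -> nat) f g : computable eG eH f -> computable eG eH g ->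
  computable eG nat_of_bool (fun c => f c == g c).
Proof.
move=> Hf Hg; apply: eq_computable (comp_eqn (comp_enc Hf) (comp_enc Hg)) => c.
by rewrite (inj_eq (@enc_inj X)).
Qed.

Lemma comp_expg G (eG : G -> nat) (d : H) n : computable eG enat n ->
  computable eG eH (fun c => d ^+ n c).
Proof.
move=> Hn; apply: (@eq_computable _ _ _ _ (fun c => iter (n c) ( *%g d) 1)).
  by move=> c; rewrite iter_mulg_1.
apply: (comp_iter (f := fun _ => *%g d) Hn (comp_const _ _ _)).
exact: comp_mul (comp_const _ _ _) (comp_snd (comp_id _)).
Qed.

Lemma comp_len G (eG : G -> nat) f : computable eG eH f -> computable eG enat (fun c => len (f c)).
Proof. by move=> /comp_fword Hf; apply: comp_size Hf. Qed.

Lemma comp_zlog G (eG : G -> nat) d f : computable eG eH f ->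
  computable eG enat (fun c => zlog d (f c)).
Proof.
move=> Hf; apply: comp_search; first exact: comp_succ (comp_len Hf).
have Hp := comp_expg d (comp_snd (comp_id (epair eG enat))).
have Hf' := comp_comp Hf (comp_fst (comp_id (epair eG enat))).
exact: comp_or (comp_eqH Hp Hf') (comp_eqH (comp_inv Hp) Hf').
Qed.

Lemma comp_phi G (eG : G -> nat) d e f : computable eG eH f ->
  computable eG eH (fun c => phi d e (f c)).
Proof.
move=> Hf; have Hz := comp_zlog d Hf; apply: comp_if.
- exact: comp_eqH (comp_expg _ Hz) Hf.
- exact: comp_expg.
exact: comp_inv (comp_expg _ Hz).
Qed.

Lemma comp_coset G (eG : G -> nat) d f n k : computable eG eH f -> computable eG enat n ->
  computable eG enat k ->
  computable eG nat_of_bool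
    (fun c => (enc (f c * d ^+ k c) == n c) || (enc (f c * d ^- k c) == n c)).
Proof.
move=> Hf Hn Hk; have Hp := comp_expg d Hk.
apply: comp_or; apply: comp_eqn => //; apply: comp_enc; apply: comp_mul => //.
exact: comp_inv.
Qed.

Lemma comp_coset_bound G (eG : G -> nat) f : computable eG eH f ->
  computable eG enat (fun c => (len (f c) + enc (f c)).+1).
Proof. by move=> Hf; apply: comp_succ; apply: comp_add; [exact: comp_len | exact: comp_enc]. Qed.

Lemma comp_rep_code G (eG : G -> nat) d f : computable eG eH f ->
  computable eG enat (fun c => rep_code d (f c)).
Proof.
move=> Hf; apply: comp_search; first exact: comp_enc Hf.
pose P (p : G * nat) k := (enc (f p.1 * d ^+ k) == p.2) || (enc (f p.1 * d ^- k) == p.2).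
pose b (p : G * nat) := (len (f p.1) + enc (f p.1)).+1.
have Hf' := comp_comp Hf (comp_fst (comp_id (epair eG enat))).
have Hb : computable (epair eG enat) enat b := comp_coset_bound Hf'.
apply: (@eq_computable _ _ _ _ (fun p => ~~ (search (P p) (b p) == b p))).
  by move=> p; rewrite -has_iota.
apply: comp_neg; apply: comp_eqn => //; apply: comp_search => //.
have i := comp_id (epair (epair eG enat) enat).
by apply: comp_coset; [exact: comp_comp Hf (comp_fst (comp_fst i)) | exact: comp_snd (comp_fst i)
  | exact: comp_snd i].
Qed.

Lemma comp_rep G (eG : G -> nat) d f : computable eG eH f ->
  computable eG eH (fun c => rep d (f c)).
Proof.
move=> Hf; have Hc := comp_rep_code d Hf.
have He : computable eG enat (fun c => rep_exp d (f c)).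
  apply: comp_search; first exact: comp_coset_bound.
  have i := comp_id (epair eG enat).
  apply: comp_coset; [exact: comp_comp Hf (comp_fst i) | exact: comp_comp Hc (comp_fst i)
    | exact: comp_snd i].
have Hp := comp_expg d He; have Hp' := comp_inv Hp.
apply: comp_if; last exact: comp_mul.
  by apply: comp_eqn => //; apply: comp_enc; apply: comp_mul.
exact: comp_mul.
Qed.

End ComputableGroup.

(** * Computability of normal forms and of prefix membership *)

Section ComputableState.
Variables (X : finType) (u v : word X).
Notation H := (free_group X).
Notation eH := (@enc X).
Notation eS := (eseq (epair nat_of_bool eH)).
Notation est := (epair eH eS).
Notation eL := (@efin (option X * bool)%type).

Lemma comp_pinch G (eG : G -> nat) e r s : computable eG eH r -> computable eG eS s ->
  computable eG nat_of_bool (fun c => pinch e (r c) (s c)).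
Proof.
move=> Hr Hs; apply: (comp_match (f1 := fun c p _ => (p.1 == ~~ e) && (r c == 1)) Hs (comp_const _
  _ _)).
have i := comp_id (epair eG (epair (epair nat_of_bool eH) eS)).
apply: comp_and; last exact: comp_eqH (comp_comp Hr (comp_fst i)) (comp_const _ _ _).
apply: (@eq_computable _ _ _ _ (fun c => nat_of_bool c.2.1.1 == ~~ e)).
  by move=> c; case: (c.2.1.1); case: e.
exact: comp_eqn (comp_enc (comp_fst (comp_fst (comp_snd i)))) (comp_const _ _ _).
Qed.

Lemma comp_stepT G (eG : G -> nat) e st : computable eG est st ->
  computable eG est (fun c => stepT u v e (st c)).
Proof.
move=> Hst; have Hh := comp_fst Hst; have Hs := comp_snd Hst.
have Hr : computable eG eH (fun c => crep u v e (st c).1) := comp_rep _ Hh.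
have Hd : computable eG eH (fun c => slide u v e ((crep u v e (st c).1)^-1 * (st c).1)).
  exact: comp_phi (comp_mul (comp_inv Hr) Hh).
have Hp : computable eG (epair nat_of_bool eH) (fun c => (e, crep u v e (st c).1)).
  exact: comp_pair (comp_const _ _ _) Hr.
apply: comp_if; first exact: comp_pinch.
  apply: comp_pair.
    apply: comp_mul => //.
    apply: (@eq_computable _ _ _ _ (fun c => if (st c).2 is p :: _ then p.2 else 1)).
      by move=> c; case: (st c).2.
    apply: (comp_match (f1 := fun c p _ => p.2) Hs (comp_const _ _ _)).
    exact: comp_snd (comp_fst (comp_snd (comp_id _))).
  apply: (@eq_computable _ _ _ _ (fun c => if (st c).2 is _ :: s then s else [::])).
    by move=> c; case: (st c).2.
  apply: (comp_match (f1 := fun c _ s => s) Hs (comp_const _ _ _)).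
  exact: comp_snd (comp_snd (comp_id _)).
by apply: comp_pair => //; apply: comp_cons.
Qed.

Lemma comp_nf G (eG : G -> nat) x : computable eG (eseq eL) x ->
  computable eG est (fun c => nf u v (x c)).
Proof.
move=> Hx; apply: (comp_foldl (f := fun _ => step u v) Hx (comp_const _ _ _)).
have i := comp_id (epair eG (epair est eL)).
apply: (comp_fin (h := fun a p => step u v p.2.1 a)) (comp_snd (comp_snd i)) => -[z b].
have Hst := comp_fst (comp_snd i).
case: z => [z|]; last exact: (comp_stepT b Hst).
apply: (comp_pair _ (comp_snd Hst)).
exact: comp_mul (comp_fst Hst) (comp_const _ _ _).
Qed.

(** The state sets and transitions of the automaton are defined by classical truth values, but they
    form a finite table for the given [u] and [v], which [comp_fin] builds into the program. *)
Lemma comp_ratb G (eG : G -> nat) j h : computable eG eH h ->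
  computable eG nat_of_bool (fun c => ratb u v j (h c)).
Proof.
move=> /comp_fword Hh.
have Hr : computable eG (@efin (dfa u v)) (fun c => foldl (@delta X u v) (dinit u v j) (fword (h
  c))).
  apply: (comp_foldl (f := fun _ => @delta X u v) Hh (comp_const _ _ _)).
  have i := comp_id (epair eG (epair (@efin (dfa u v)) (@efin (X * bool)%type))).
  apply: (comp_fin (h := fun a p => @delta X u v p.2.1 a)) (comp_snd (comp_snd i)) => a.
  apply: (comp_fin (h := fun d _ => @delta X u v d a)) (comp_fst (comp_snd i)) => d.
  exact: comp_const.
by apply: (comp_fin (h := fun d _ => @dacc X u v d)) Hr => d; exact: comp_const.
Qed.

Notation eQ := (epair (@efin (option phase)) eH).

Lemma comp_summary_next G (eG : G -> nat) j g : computable eG eH g ->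
  computable eG eQ (fun c => summary_next u v j (g c)).
Proof.
move=> Hg; have Hw : computable eG enat (fun c => window u v (g c)).
  exact: comp_add (comp_succ (comp_len Hg)) (comp_const _ _ _).
have Hw' := comp_inv (comp_expg (free_class v) Hw).
apply: comp_if; last apply: comp_if; try exact: comp_const.
- apply: comp_neg; apply: comp_ratb; exact: comp_mul Hg (comp_expg _ Hw).
- by apply: comp_ratb; exact: comp_mul Hg Hw'.
apply: comp_pair; first exact: comp_const.
apply: comp_mul; first exact: comp_inv (comp_expg _ Hw).
apply: comp_expg; apply: comp_search; first exact: comp_add.
have i := comp_id (epair eG enat).
apply: comp_ratb; apply: comp_mul; last exact: comp_expg (comp_snd i).
exact: comp_comp (comp_mul Hg Hw') (comp_fst i).
Qed.

Lemma comp_summary G (eG : G -> nat) s : computable eG eS s ->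
  computable eG eQ (fun c => summary u v (s c)).
Proof.
move=> Hs; apply: (@eq_computable _ _ _ _
  (fun c => foldl (fun q p => summary_step u v p q) (Some (Some true), 1) (rev (s c)))).
  by move=> c; rewrite foldl_rev.
apply: (comp_foldl (f := fun _ q p => summary_step u v p q) (comp_rev Hs) (comp_const _ _ _)).
have i := comp_id (epair eG (epair eQ (epair nat_of_bool eH))).
have Hq := comp_fst (comp_snd i); have Hp := comp_snd (comp_snd i).
apply: comp_if; [exact: comp_fst Hp | | exact: comp_const].
pose h (o : option phase) (c : G * ((option phase * H) * (bool * H))) :=
  if o is Some j then summary_next u v j (c.2.1.2^-1 * c.2.2.2) else (None, 1).
apply: (comp_fin (h := h)) (comp_fst Hq) => -[j|]; last exact: comp_const.
exact: comp_summary_next (comp_mul (comp_inv (comp_snd Hq)) (comp_snd Hp)).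
Qed.

Definition prefix_memb (x : word (option X)) : bool :=
  let q := summary u v (nf u v x).2 in
  if q.1 is Some j then ratb u v j (q.2^-1 * (nf u v x).1) else false.

Lemma comp_prefix_memb G (eG : G -> nat) x : computable eG (eseq eL) x ->
  computable eG nat_of_bool (fun c => prefix_memb (x c)).
Proof.
move=> /comp_nf Hx; have Hq := comp_summary (comp_snd Hx).
pose h (o : option phase) c := if o is Some j
  then ratb u v j ((summary u v (nf u v (x c)).2).2^-1 * (nf u v (x c)).1) else false.
apply: (comp_fin (h := h)) (comp_fst Hq) => -[j|]; last exact: comp_const.
exact: comp_ratb (comp_mul (comp_inv (comp_snd Hq)) (comp_fst Hx)).
Qed.

Lemma prefix_membP x : u != [::] -> v != [::] -> reduced u -> reduced v ->
  prefix_monoid (Gp_elt (relator u v) x) <-> prefix_memb x.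
Proof.
move=> un vn ur vr; rewrite prefix_monoid_stack_mem // summaryP // /summary_set /prefix_memb.
by case: (summary u v _) => [[j|] a] //=; apply: ratbP.
Qed.

Lemma comp_Gp_eq G (eG : G -> nat) x y : computable eG (eseq eL) x -> computable eG (eseq eL) y ->
  computable eG nat_of_bool (fun c => nf u v (x c) == nf u v (y c)).
Proof.
move=> Hx Hy.
apply: eq_computable (comp_eqn (comp_enc (comp_nf Hx)) (comp_enc (comp_nf Hy))) => c.
rewrite (inj_eq (epair_inj (@enc_inj X) _)) //.
exact: eseq_inj (epair_inj nat_of_bool_inj (@enc_inj X)).
Qed.

End ComputableState.

Theorem prefix_decidable (X : finType) (u v : word X) :
    u != [::] -> v != [::] -> reduced u -> reduced v ->
  prefix_membership_decidable (relator u v).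
Proof.
move=> un vn ur vr.
have [F rF eF] := comp_prefix_memb u v (comp_id (eseq (@efin (option X * bool)%type))).
exists (fun t => F (thead t)) => // p.
rewrite theadE prefix_membP // -[word_code p]/(eseq (@efin _) p) eF.
by case: (prefix_memb u v p).
Qed.

(** * The inverse monoid *)

Section InverseMonoid.
Variables (Z : choiceType) (w : word Z).
Implicit Types (x y z : word Z) (m : Inv w).
Notation i := (Inv_elt w).

Lemma Inv_eltM x y : i (x ++ y) = i x * i y.
Proof.
rewrite /Inv_elt (_ : fim_class (x ++ y) = fim_class x * fim_class y).
  by symmetry; apply: mclassM.
by symmetry; apply: mclassM.
Qed.

Lemma Inv_elt_relator : i w = 1.
Proof. by apply/mclassP/cong_base. Qed.

Lemma Inv_elt_regular x : i x * i (word_inv x) * i x = i x.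
Proof.
rewrite -!Inv_eltM /Inv_elt; congr (mclass _ _).
by apply/mclassP/cong_base; exact: (VagnerInv x).
Qed.

Lemma Inv_elt_idem_comm x y :
  i x * i (word_inv x) * (i y * i (word_inv y)) = i y * i (word_inv y) * (i x * i (word_inv x)).
Proof.
rewrite -!Inv_eltM /Inv_elt; congr (mclass _ _).
by apply/mclassP/cong_base; exact: (VagnerComm x y).
Qed.

Lemma Inv_elt_ind (E : word Z -> word Z -> Prop) :
    (forall x, E x x) -> (forall x y, E x y -> E y x) ->
    (forall y x z, E x y -> E y z -> E x z) ->
    (forall x x' y y', E x x' -> E y y' -> E (x ++ y) (x' ++ y')) ->
    (forall x y, vagner x y -> E x y) -> E w [::] ->
  forall x y, i x = i y -> E x y.
Proof.
move=> Er Es Et Em Ev Ew.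
have Ef x y : fim_class x = fim_class y -> E x y.
  move/mclassP; elim=> {x y} [x y /Ev|x|x y _ IH1|y x z _ IH1 _ IH2|x x' y y' _ IH1 _ IH2] //.
  - exact: Es.
  - exact: Et IH1 IH2.
  exact: (Em _ _ _ _ IH1 IH2).
have fimM x y : fim_class (x ++ y) = fim_class x * fim_class y.
  by symmetry; apply: mclassM.
have rK (g : free_inverse_monoid Z) : fim_class (mquot_repr g) = g by apply: mquot_reprK.
move=> x y /mclassP; move Eg: (fim_class x) => g; move Eh: (fim_class y) => h C.
elim: C x y Eg Eh => {g h} [g h [-> ->] x y /Ef Ex Ey|g x y <- /Ef/Es //|g h _ IH x y Ex Ey|
  h g k _ IH1 _ IH2 x y Ex Ey|g g' h h' _ IH1 _ IH2 x y Ex Ey].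
- apply: Et Ex (Et _ _ _ Ew _); exact: Ef.
- by apply: Es; apply: IH.
- by apply: (Et (mquot_repr h)); [apply: IH1|apply: IH2]; rewrite ?rK.
apply: (Et (mquot_repr g ++ mquot_repr h)); first by apply: Ef; rewrite fimM !rK.
apply: (Et (mquot_repr g' ++ mquot_repr h')); last by apply: Ef; rewrite fimM !rK.
by apply: Em; [apply: IH1|apply: IH2]; rewrite rK.
Qed.

(* The paths of the Schuetzenberger graphs, whose vertices are all the elements of [Inv w]. *)
Definition path_from m x m' := m * i x = m' /\ m' * i (word_inv x) = m.

Lemma path_det m x m1 m2 : path_from m x m1 -> path_from m x m2 -> m1 = m2.
Proof. by move=> [<- _] [<- _]. Qed.

Lemma path_nil m : path_from m [::] m.
Proof. by split; exact: mulg1. Qed.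

Lemma path_cat m x m1 y m2 : path_from m x m1 -> path_from m1 y m2 -> path_from m (x ++ y) m2.
Proof.
move=> [<- E1] [<- E2]; split; first by rewrite Inv_eltM mulgA.
by rewrite word_invM Inv_eltM mulgA E2.
Qed.

Lemma path_inv m x m' : path_from m x m' -> path_from m' (word_inv x) m.
Proof. by move=> [E1 E2]; split=> //; rewrite word_invK. Qed.

(** From [m = m x y y^-1 x^-1] one gets [m x = m x (y y^-1) (x^-1 x)]; the idempotents commute, so
    this is [m x y y^-1]. Hence the [y]-part is reversible by itself. *)
Lemma path_split m x y m2 : path_from m (x ++ y) m2 ->
  exists2 m1, path_from m x m1 & path_from m1 y m2.
Proof.
rewrite /path_from word_invM !Inv_eltM => -[<-]; rewrite !mulgA => E.
have E' : m * i x * i y * i (word_inv y) = m * i x.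
  have C := Inv_elt_idem_comm y (word_inv x); rewrite word_invK in C.
  rewrite -{2}E -!mulgA; congr (m * _).
  by rewrite (mulgA (i y)) C !mulgA Inv_elt_regular.
exists (m * i x); last by rewrite E'.
by split=> //; rewrite -E' E.
Qed.

(** Regularity turns [w = 1] into [w^-1 = 1], so the relator labels a loop at every vertex. *)
Lemma path_relator m : path_from m w m.
Proof.
have E : i (word_inv w) = 1.
  by have := Inv_elt_regular w; rewrite Inv_elt_relator mul1g mulg1.
by split; rewrite ?E ?Inv_elt_relator mulg1.
Qed.

Lemma path_push m a s m' : path_from m (a :: s) m' -> path_from m (push a s) m'.
Proof.
case: s => [|b s] //=; case: eqP => // -> /(@path_split _ [:: a; letter_inv a] s) [m1 p1 p2].
have [m2 q1 q2] := @path_split m [:: a] [:: letter_inv a] m1 p1.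
by have := path_det (path_inv q1) q2 => ->.
Qed.

Lemma path_red m x m' : path_from m x m' -> path_from m (red x) m'.
Proof.
elim: x m => //= a x IH m /(@path_split m [:: a] x m') [m1 p1 p2].
by apply: path_push; apply: (@path_cat m [:: a] m1) => //; apply: IH.
Qed.

End InverseMonoid.

(** * Paths and normal forms in the inverse monoid *)

Section Folding.
Variables (X : finType) (u v : word X).
Hypotheses (u_neq_nil : u != [::]) (v_neq_nil : v != [::]).
Hypotheses (u_reduced : reduced u) (v_reduced : reduced v).
Notation H := (free_group X).
Notation w := (relator u v).
Notation assoc := (assoc u v).
Implicit Types (m : Inv w) (h : H) (s : seq (bool * H)).

Definition hpath m h m' := path_from m (map_word Some (fword h)) m'.
Definition tpath m e m' := path_from m [:: tletter X e] m'.

Lemma red_map_word (x : word X) : red (map_word Some x) = map_word (@Some X) (red x).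
Proof.
elim: x => //= a x ->; case: (red x) => //= b y.
rewrite (_ : ((Some b.1, b.2) == letter_inv (Some a.1, a.2)) = (b == letter_inv a));
  first by case: eqP.
by case: a b => a ea [b eb]; rewrite /letter_inv !xpair_eqE.
Qed.

Lemma hpath_word m (x : word X) m' : path_from m (map_word Some x) m' -> hpath m (free_class x) m'.
Proof. by move/path_red; rewrite red_map_word /hpath fwordE. Qed.

Lemma hpathM m g m1 h m2 : hpath m g m1 -> hpath m1 h m2 -> hpath m (g * h) m2.
Proof.
move=> p q; rewrite -(fwordK g) -(fwordK h) -free_classM; apply: hpath_word.
by rewrite map_word_cat; apply: path_cat p q.
Qed.

Lemma hpathV m g m' : hpath m g m' -> hpath m' g^-1 m.
Proof.
move/path_inv; rewrite -map_word_inv => /hpath_word.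
by rewrite free_classV fwordK.
Qed.

Lemma hpath1 m : hpath m 1 m.
Proof. by rewrite /hpath fwordE; apply: path_nil. Qed.

Lemma tpathV m e m' : tpath m e m' -> tpath m' (~~ e) m.
Proof. exact: path_inv. Qed.

Lemma path_relator_parts m : exists m1 m2 m3,
  [/\ tpath m true m1, hpath m1 (assoc false) m2, tpath m2 false m3 & hpath m (assoc true) m3].
Proof.
have := path_relator m; rewrite [X in path_from _ X _]relatorE => /path_split [m1 p1 /path_split
  [m2 p2 /path_split [m3 p3 p4]]].
exists m1, m2, m3; split=> //; first exact: hpath_word.
by apply: hpath_word; have := path_inv p4; rewrite word_invK.
Qed.

(* The relators read at consecutive points of the path v^n glue to a ladder whose rungs are
  t-edges. *)
Lemma parallel m m1 n : tpath m true m1 -> exists m2 m3,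
  [/\ hpath m1 (assoc false ^+ n) m2, tpath m2 false m3 & hpath m (assoc true ^+ n) m3].
Proof.
move=> p; elim: n => [|n [m2 [m3 [p1 p2 p3]]]].
  by exists m1, m; split; [exact: hpath1 | exact: tpathV p | exact: hpath1].
have [m4 [m5 [m6 [q1 q2 q3 q4]]]] := path_relator_parts m3.
have e := path_det (tpathV p2) q1; rewrite -e in q2.
by exists m5, m6; rewrite !expgSr; split=> //; apply: hpathM; eassumption.
Qed.

(** The first stable edge of the path starts a ladder with sides [u^n] and [v^n]. By determinism one
    side and the last rung coincide with the given path, and the other side is the bypass. *)
Lemma pinch_pos e m m1 m2 m3 n : tpath m (~~ e) m1 -> hpath m1 (assoc e ^+ n) m2 -> tpath m2 e m3 ->
  hpath m (assoc (~~ e) ^+ n) m3.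
Proof.
case: e => p1 p2 p3.
  have [m4 [m5 [q1 q2 q3]]] := parallel n (tpathV p1).
  by rewrite -(path_det q3 p2) in p3; rewrite -(path_det (tpathV q2) p3).
have [m4 [m5 [q1 q2 q3]]] := parallel n p1.
by rewrite -(path_det q1 p2) in p3; rewrite (path_det p3 q2).
Qed.

Lemma path_pinch e m m1 m2 m3 k l : tpath m (~~ e) m1 -> hpath m1 (zexp (assoc e) k l) m2 ->
  tpath m2 e m3 -> hpath m (zexp (assoc (~~ e)) k l) m3.
Proof.
rewrite !zexpE; case: leqP => _ p1 p2 p3; first exact: pinch_pos p1 p2 p3.
(* A negative exponent becomes positive when the path is traversed backwards. *)
have p1' := tpathV p1; rewrite negbK in p1'.
by apply: hpathV; apply: pinch_pos (tpathV p3) _ p1'; rewrite -[_ ^+ _]invgK; apply: hpathV.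
Qed.

(* A path following a state up to sliding powers of [assoc e] across its stable letters *)
Fixpoint follows m s h m' : Prop :=
  if s is (e, r) :: s' then exists k l m1 m2, [/\ follows m s' (r * zexp (assoc e) k l) m1,
    tpath m1 e m2 & hpath m2 (zexp (assoc (~~ e)) l k * h) m']
  else hpath m h m'.

Lemma follows_mul m s h m1 g m2 : follows m s h m1 -> hpath m1 g m2 -> follows m s (h * g) m2.
Proof.
case: s => [|[e r] s] /=; first exact: hpathM.
move=> [k [l [m3 [m4 [p1 p2 p3]]]]] q; exists k, l, m3, m4; split=> //.
by rewrite mulgA; apply: hpathM q.
Qed.

Lemma follows_stepT m e st m1 m2 : follows m st.2 st.1 m1 -> tpath m1 e m2 ->
  follows m (stepT u v e st).2 (stepT u v e st).1 m2.
Proof.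
case: st => h s; rewrite /stepT /=.
have [k [l Er]] := crep_cyc u_neq_nil v_neq_nil u_reduced v_reduced e h.
have Ed : slide u v e ((crep u v e h)^-1 * h) = zexp (assoc (~~ e)) k l.
  by rewrite Er /slide phi_zexp //; apply: assoc_unbounded.
move=> p q; case pc: (pinch _ _ _) => /=; last first.
  exists k, l, m1, m2; split=> //; first by rewrite -Er mulVKg.
  by rewrite Ed zexpD zexpE addnC leqnn subnn; apply: hpath1.
move: p; case: s pc => //= -[e' r'] s /= /andP[/eqP -> /eqP r1].
move=> [k1 [l1 [m3 [m4 [p1 p2 p3]]]]]; rewrite Ed.
rewrite r1 invg1 mul1g in Er; rewrite negbK Er zexpD in p3.
(* The exponent [k1 - l1] of the earlier slide cancels against its inverse in the bypass, so only
   [k - l] remains. *)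
have := follows_mul p1 (path_pinch p2 p3 q).
by rewrite -mulgA zexpD (@zexp_congr _ _ _ _ k l) //; lia.
Qed.

Lemma follows_act m st m1 x m2 : follows m st.2 st.1 m1 -> path_from m1 x m2 ->
  follows m (act u v st x).2 (act u v st x).1 m2.
Proof.
elim: x st m1 => [|[[z|] b] x IH] st m1 f p; first by rewrite -(path_det (path_nil m1) p).
  have [m3 p1 p2] := @path_split _ _ m1 [:: (Some z, b)] x m2 p.
  apply: IH p2; rewrite /step /=; apply: follows_mul f _.
  exact: (@hpath_word m1 [:: (z, b)]).
have [m3 p1 p2] := @path_split _ _ m1 [:: tletter X b] x m2 p.
by apply: IH p2; apply: follows_stepT f p1.
Qed.

Lemma follows_nf m x m' : path_from m x m' -> follows m (nf u v x).2 (nf u v x).1 m'.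
Proof. by apply: follows_act; apply: hpath1. Qed.

(* The Schuetzenberger graphs embed in the Cayley graph of the group. *)
Lemma path_closed m x m' : path_from m x m' -> Gp_elt w x = 1 -> m = m'.
Proof.
move=> p E; have En : nf u v x = nf u v [::] by apply/nf_eq.
by have := follows_nf p; rewrite En; apply: path_det; apply: hpath1.
Qed.

(* The embedding is onto a full subgraph. *)
Lemma path_letter m x m' a : path_from m x m' -> Gp_elt w x = Gp_elt w [:: a] ->
  path_from m [:: a] m'.
Proof.
move=> p; case: a => [[z|] b].
  have N : nf u v [:: (Some z, b)] = (1 * free_class [:: (z, b)], [::]) by [].
  move=> /nf_eq E; have := follows_nf p; rewrite E // N /= mul1g /hpath fwordE.
  by [].
(* The relator begins with [t^-1], so every vertex has an outgoing edge [t^-1]; its end is that of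
   any path with the same value in the group. An edge [t] is one of these reversed. *)
have inverse m1 m2 y : path_from m1 y m2 -> Gp_elt w y = stable u v true -> tpath m1 true m2.
  move=> q Ey; have [m3 [_ [_ [p3 _ _ _]]]] := path_relator_parts m1.
  have p4 := path_cat (path_inv q) p3.
  by rewrite (path_closed p4) // Gp_eltM Gp_eltV Ey mulVg.
case: b => E; first exact: inverse p E.
apply: (@tpathV m' true); apply: inverse (path_inv p) _.
by rewrite Gp_eltV E (stable_inv u v true).
Qed.

(** The relator loop exists at every vertex, so its prefixes, and the products of these, can be read
    from everywhere. *)
Lemma path_prefix_monoid (g : Gp w) : prefix_monoid g ->
  exists2 x, Gp_elt w x = g & forall m, exists m', path_from m x m'.
Proof.
elim=> {g} [g [q pq ->]||g h _ [x <- Px] _ [y <- Py]].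
- exists q => // m; have := path_relator m.
  rewrite -[X in path_from _ X _](cat_take_drop (size q)) -(prefix_take_eq pq) => /path_split [m1 p
    _].
  by exists m1.
- by exists [::] => // m; exists m; apply: path_nil.
exists (x ++ y); first exact: Gp_eltM.
by move=> m; have [m1 p] := Px m; have [m2 q] := Py m1; exists m2; apply: path_cat p q.
Qed.

(** The prefix monoid is closed under products, so inclusion of the unions of translates need only
    be tested at the finitely many prefixes of [y]. *)
Definition covers (x y : word (option X)) := forall y', prefix y' y ->
  exists2 x', prefix x' x & prefix_monoid (Gp_elt w (word_inv x' ++ y')).

(** The path of [y] is built letter by letter. Going back along [y'], then along [x'] and a word for
    an element of the prefix monoid, gives a path with the group value of the next letter; fullness
    turns it into an edge. *)
Lemma covers_path x y : covers x y ->
  exists m, path_from (Inv_elt w x * Inv_elt w (word_inv x)) y m.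
Proof.
set m0 := _ * _ => cov.
have px : path_from m0 x (Inv_elt w x).
  by split=> //; rewrite /m0 Inv_elt_regular.
have : prefix y y by apply: prefix_refl.
move: {-2}y; elim/last_ind => [|y' a IH] pr; first by exists m0; apply: path_nil.
have [m1 p1] : exists m1, path_from m0 y' m1.
  by apply: IH; apply: prefix_trans pr; apply: prefix_rcons.
have [x' px' /path_prefix_monoid [z Ez Pz]] := cov _ pr.
have [m2 p2] : exists m2, path_from m0 x' m2.
  move: px; rewrite -[X in path_from _ X _](cat_take_drop (size x')) -(prefix_take_eq px').
  by case/path_split => m2 p2 _; exists m2.
have [m3 p3] := Pz m2.
exists m3; rewrite -cats1; apply: (path_cat p1 _).
apply: (@path_letter _ (word_inv y' ++ (x' ++ z))).
  by apply: path_cat (path_inv p1) (path_cat p2 p3).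
rewrite !Gp_eltM Ez !Gp_eltM !Gp_eltV mulVKg -cats1 Gp_eltM.
by rewrite mulKg.
Qed.

(** The paths of [x] and [y] from [x x^-1] both exist and have equal group values, hence equal ends.
    The conclusion is [x <= y] in the natural partial order. *)
Lemma covers_le x y : covers x y -> Gp_elt w x = Gp_elt w y ->
  Inv_elt w x = Inv_elt w x * Inv_elt w (word_inv x) * Inv_elt w y.
Proof.
move=> /covers_path [m p] E.
have px : path_from (Inv_elt w x * Inv_elt w (word_inv x)) x (Inv_elt w x).
  by split=> //; rewrite Inv_elt_regular.
case: (p) => -> _; apply: (path_closed (path_cat (path_inv px) p)).
by rewrite Gp_eltM Gp_eltV E mulVg.
Qed.

(** The analogue of the Munn tree in the Cayley graph of the group. Together with the group value it
    is an invariant of the inverse monoid, which shows that the covering criterion is necessary. *)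
Definition closure (x : word (option X)) (g : Gp w) : Prop :=
  exists2 x', prefix x' x & prefix_monoid ((Gp_elt w x')^-1 * g).

Lemma prefix_cat2l (T : eqType) (x y z : seq T) : prefix y z -> prefix (x ++ y) (x ++ z).
Proof. by move=> p; rewrite prefix_catr // eqxx. Qed.

Lemma closure_cat x y (g : Gp w) : closure (x ++ y) g <->
  closure x g \/ closure y ((Gp_elt w x)^-1 * g).
Proof.
split=> [[z /prefix_cat_cases [pz|[z' pz ->]] P]|[[z pz P]|[z pz P]]].
- by left; exists z.
- by right; exists z' => //; move: P; rewrite Gp_eltM invgM -!mulgA.
- by exists z => //; apply: prefix_catl.
exists (x ++ z); first exact: prefix_cat2l.
by rewrite Gp_eltM invgM -mulgA.
Qed.

Lemma closure_inv x (g : Gp w) : closure (word_inv x) g <-> closure x (Gp_elt w x * g).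
Proof.
have le y (h : Gp w) : closure (word_inv y) h -> closure y (Gp_elt w y * h).
  case=> z pz; set k := size y - size z => P; exists (take k y); first exact: prefix_take.
  move: P; rewrite (_ : z = word_inv (drop k y)); last first.
    by rewrite {1}(prefix_take_eq pz) /word_inv take_rev size_map map_drop.
  rewrite Gp_eltV invgK.
  have -> : Gp_elt w y = Gp_elt w (take k y) * Gp_elt w (drop k y).
    by rewrite -Gp_eltM cat_take_drop.
  by rewrite -mulgA mulKg.
split=> [/le //|c]; have := le (word_inv x) (Gp_elt w x * g).
by rewrite word_invK Gp_eltV mulKg; apply.
Qed.

Lemma closure_idem x (g : Gp w) : closure (x ++ word_inv x) g <-> closure x g.
Proof.
rewrite closure_cat closure_inv mulVKg; split; [by case | by left].
Qed.

Lemma prefix_monoid_closure (g : Gp w) : closure [::] g <-> prefix_monoid g.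
Proof.
split=> [[[|//] _]|P]; first by rewrite Gp_elt1 invg1 mul1g.
by exists [::]; rewrite ?Gp_elt1 ?invg1 ?mul1g.
Qed.

Lemma closure_relator (g : Gp w) : closure w g <-> prefix_monoid g.
Proof.
split=> [[q pq P]|P].
  rewrite -[g](mulVKg (Gp_elt w q)); apply: gen_mul P.
  by apply: gen_base; exists q.
by exists [::]; rewrite ?prefix0s ?Gp_elt1 ?invg1 ?mul1g.
Qed.

(** The word [x x^-1] has group value 1 and visits, up to the prefix monoid, the same vertices as
    [x]; repeating or permuting such detours changes nothing. *)
Lemma closure_vagner x y : vagner x y -> Gp_elt w x = Gp_elt w y /\
  forall g : Gp w, closure x g <-> closure y g.
Proof.
have M1 z : Gp_elt w (z ++ word_inv z) = 1 by rewrite Gp_eltM Gp_eltV mulgV.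
case=> {x y} [x|x y].
  split=> [|g]; first by rewrite -[_ * _]/((x ++ word_inv x) ++ x) Gp_eltM M1 mul1g.
  rewrite -[_ * _]/((x ++ word_inv x) ++ x) closure_cat M1 invg1 mul1g closure_idem.
  by split; [case | left].
rewrite -[_ * (y * _)]/((x ++ word_inv x) ++ (y ++ word_inv y)).
rewrite -[_ * (x * _)]/((y ++ word_inv y) ++ (x ++ word_inv x)).
split=> [|g]; first by rewrite (Gp_eltM _ (x ++ _)) (Gp_eltM _ (y ++ _)) !M1.
rewrite (closure_cat (x ++ _)) (closure_cat (y ++ _)) !M1 invg1 !mul1g !closure_idem.
by split=> -[]; [right | left | right | left].
Qed.

Lemma Inv_elt_closure x y : Inv_elt w x = Inv_elt w y ->
  Gp_elt w x = Gp_elt w y /\ forall g, closure x g <-> closure y g.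
Proof.
apply: (Inv_elt_ind (E := fun x y => Gp_elt w x = Gp_elt w y /\
  forall g, closure x g <-> closure y g)) => {x y}.
- by [].
- by move=> x y [-> E]; split=> // g; rewrite E.
- by move=> y x z [-> E] [-> E']; split=> // g; rewrite E.
- move=> x x' y y' [Ex Cx] [Ey Cy]; split=> [|g]; first by rewrite !Gp_eltM Ex Ey.
  by rewrite !closure_cat Cx Cy Ex.
- exact: closure_vagner.
split=> [|g]; first exact: Gp_elt_relator.
by rewrite closure_relator prefix_monoid_closure.
Qed.

Lemma closure_covers x y : (forall g, closure y g -> closure x g) -> covers x y.
Proof.
move=> le y' py; have [|x' px P] := le (Gp_elt w y').
  by exists y' => //; rewrite mulVg; apply: gen_one.
by exists x' => //; rewrite Gp_eltM Gp_eltV.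
Qed.

Theorem Inv_elt_eq x y : Inv_elt w x = Inv_elt w y <->
  [/\ Gp_elt w x = Gp_elt w y, covers x y & covers y x].
Proof.
split=> [/Inv_elt_closure [E C]|[E Cxy Cyx]].
  by split=> //; apply: closure_covers => g /C.
have Ex := covers_le Cxy E; have Ey := covers_le Cyx (esym E).
(* Antisymmetry of the natural order: [x = x x^-1 y = x x^-1 y y^-1 x = y y^-1 x x^-1 x = y y^-1 x =
   y]. *)
rewrite Ex {1}Ey mulgA Inv_elt_idem_comm -mulgA.
rewrite Inv_elt_regular.
by rewrite -Ey.
Qed.

End Folding.

(** * Deciding equality in the inverse monoid *)

Section Covers.
Variables (X : finType) (u v : word X).
Hypotheses (u_neq_nil : u != [::]) (v_neq_nil : v != [::]).
Hypotheses (u_reduced : reduced u) (v_reduced : reduced v).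
Notation eL := (@efin (option X * bool)%type).

Definition coversb (x y : word (option X)) : bool :=
  ~~ has (fun k => ~~ has (fun l => prefix_memb u v (word_inv (drop_last l x) ++ drop_last k y))
    (iota 0 (size x).+1)) (iota 0 (size y).+1).

Lemma coversP x y : covers u v x y <-> coversb x y.
Proof.
split=> [cov|/hasPn cov y' py].
  apply/hasPn => k _; rewrite negbK; have [|x' px P] := cov (drop_last k y).
    by rewrite drop_lastE prefix_take.
  apply/hasP; exists (size x - size x')%N; first by rewrite mem_iota add0n ltnS leq_subr.
  by rewrite drop_lastE subKn ?size_prefix // -(prefix_take_eq px); apply/prefix_membP.
have := cov (size y - size y')%N; rewrite mem_iota add0n ltnS leq_subr => /(_ isT).
rewrite negbK => /hasP [l _]; rewrite (drop_lastE _ y) subKn ?size_prefix // -(prefix_take_eq py)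
  => /prefix_membP P.
by exists (drop_last l x); [rewrite drop_lastE prefix_take | apply: P].
Qed.

Lemma comp_covers G (eG : G -> nat) x y : computable eG (eseq eL) x -> computable eG (eseq eL) y ->
  computable eG nat_of_bool (fun c => coversb (x c) (y c)).
Proof.
move=> Hx Hy; apply: comp_neg; apply: comp_has; first exact: comp_succ (comp_size Hy).
have i := comp_id (epair eG enat).
apply: comp_neg; apply: comp_has; first exact: comp_succ (comp_size (comp_comp Hx (comp_fst i))).
have i2 := comp_id (epair (epair eG enat) enat).
apply: comp_prefix_memb; apply: comp_cat.
  by apply: comp_word_inv; apply: comp_drop_last (comp_snd i2) (comp_comp Hx (comp_fst (comp_fst
    i2))).
exact: comp_drop_last (comp_snd (comp_fst i2)) (comp_comp Hy (comp_fst (comp_fst i2))).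
Qed.

Lemma Inv_decidable : Inv_word_problem_decidable (relator u v).
Proof.
pose f (p : word (option X) * word (option X)) : bool :=
  (nf u v p.1 == nf u v p.2) && (coversb p.1 p.2 && coversb p.2 p.1).
have [F rF eF] : computable (epair (eseq eL) (eseq eL)) nat_of_bool f.
  have i := comp_id (epair (eseq eL) (eseq eL)); have H1 := comp_fst i; have H2 := comp_snd i.
  by apply: comp_and; [apply: comp_Gp_eq | apply: comp_and; apply: comp_covers].
exists (fun t => F (pairn (thead t) (tnth t (inord 1)))).
  exact: (rec21_comp rF rec2_pairn).
move=> x y; rewrite theadE (_ : tnth _ (inord 1) = word_code y); last first.
  by rewrite (tnth_nth 0) /= inordK.
rewrite -[pairn _ _]/(epair (eseq eL) (eseq eL) (x, y)) eF Inv_elt_eq //.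
have -> : (f (x, y) = 1%N :> nat) <-> f (x, y) by case: (f _).
split=> [/and3P[/eqP/nf_eq E /coversP C /coversP C']|[E C C']].
  by split=> //; apply: E.
by apply/and3P; split; [apply/eqP/nf_eq | apply/coversP | apply/coversP].
Qed.

End Covers.

(* The alphabet X \cup {t} is option X, with t = None. *)
Theorem theorem7p10 (X : finType) (u v : word X)
    (u_neq_nil : u != [::]) (v_neq_nil : v != [::])
    (u_reduced : reduced u) (v_reduced : reduced v) :
  let t : word (option X) := [:: (None, false)] in
  let w := t^-1 * map_word Some u * t * (map_word Some v)^-1 in
  prefix_membership_decidable w /\ Inv_word_problem_decidable w.
Proof. by split; [apply: prefix_decidable | apply: Inv_decidable]. Qed.
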